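(* Let $p>3$ be a prime and let $t\in\mathbb{F}_p$ with $t\neq 0,1$. Then $${_2}G_2\left[\begin{array}{cc}\frac16, & \frac56\\ 0, & 0\end{array}\Big|\,\frac1t\right]_p=\varphi(-1)\cdot{_2}G_2\left[\begin{array}{cc}\frac16, & \frac56\\ 0, & 0\end{array}\Big|\,\frac1{1-t}\right]_p,$$ where ${_2}G_2[\cdots]_p$ is McCarthy's $p$-adic hypergeometric function and $\varphi$ is the quadratic character on $\mathbb{F}_p$.
   Context: Let $p$ be an odd prime, $\mathbb{F}_p$ the field with $p$ elements, $\mathbb{Z}_p$ the $p$-adic integers, $\mathbb{Q}_p$ the $p$-adic numbers. Multiplicative characters $\chi$ of $\mathbb{F}_p^\times$ are extended to $\mathbb{F}_p$ by $\chi(0):=0$ (including the trivial character). $\varphi$ is the quadratic character on $\mathbb{F}_p$ (the Legendre symbol). $\omega:\mathbb{F}_p^\times\to\mathbb{Z}_p^\times$ is the Teichmüller character: $\omega(a)$ is the $(p-1)$-th root of unity in $\mathbb{Z}_p$ with $\omega(a)\equiv a\pmod p$; $\overline{\omega}=\omega^{-1}$. For $x\in\mathbb{Q}$, $\lfloor x\rfloor$ is the greatest integer $\le x$ and $\langle x\rangle:=x-\lfloor x\rfloor$. The $p$-adic gamma function is defined on positive integers by $\Gamma_p(n):=(-1)^n\prod_{0<j<n,\ p\nmid j}j$, extended continuously to $\Gamma_p:\mathbb{Z}_p\to\mathbb{Z}_p^\times$ by $\Gamma_p(0):=1$ and $\Gamma_p(x):=\lim_{x_n\to x}\Gamma_p(x_n)$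 for $x\neq0$, where $x_n$ runs through any sequence of positive integers $p$-adically approaching $x$. McCarthy's $p$-adic hypergeometric function: for $t\in\mathbb{F}_p$, a positive integer $n$, and $a_k,b_k\in\mathbb{Q}\cap\mathbb{Z}_p$ ($1\le k\le n$), $${_n}G_n\left[\begin{array}{cccc}a_1,&a_2,&\ldots,&a_n\\ b_1,&b_2,&\ldots,&b_n\end{array}\Big|\,t\right]_p:=\frac{-1}{p-1}\sum_{a=0}^{p-2}(-1)^{an}\,\overline{\omega}^a(t)\prod_{k=1}^n(-p)^{-\lfloor\langle a_k\rangle-\frac{a}{p-1}\rfloor-\lfloor\langle -b_k\rangle+\frac{a}{p-1}\rfloor}\frac{\Gamma_p(\langle a_k-\frac{a}{p-1}\rangle)}{\Gamma_p(\langle a_k\rangle)}\cdot\frac{\Gamma_p(\langle -b_k+\frac{a}{p-1}\rangle)}{\Gamma_p(\langle -b_k\rangle)}\in\mathbb{Q}_p.$$ *)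

(* Defs.v *)
From HB Require Import structures.
From mathcomp Require Import all_boot all_order all_algebra.
From mathcomp Require Import boolp classical_sets.

Set Implicit Arguments.
Unset Strict Implicit.
Unset Printing Implicit Defensive.

Import Order.TTheory GRing.Theory Num.Theory.
Local Open Scope ring_scope.

(* Z_p as the inverse limit of the rings Z/p^k: x is the family of its least
   nonnegative residues, zres x k being the residue of x modulo p^k (so
   zres x 0 = 0). The proof of primality is an argument of the type in order to
   make the integral domain structure canonical. *)
Record zpadic (p : nat) (p_pr : prime p) : Type := ZPadic {
  zres : nat -> nat;
  zresP : forall k, (zres k.+1 %% p ^ k = zres k)%N
}.

HB.instance Definition _ (p : nat) (p_pr : prime p) :=
  gen_eqMixin (zpadic p_pr).
HB.instance Definition _ (p : nat) (p_pr : prime p) :=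
  gen_choiceMixin (zpadic p_pr).

Lemma zpadic_eq (p : nat) (p_pr : prime p) (x y : zpadic p_pr) :
  (forall k, zres x k = zres y k) -> x = y.
Proof.
case: x y => [u uP] [v vP] /= /funext uv; rewrite uv in uP *.
by congr ZPadic; exact: Prop_irrelevance.
Qed.

Lemma zres_mod (p : nat) (p_pr : prime p) (x : zpadic p_pr) k :
  (zres x k %% p ^ k)%N = zres x k.
Proof. by rewrite -zresP modn_mod. Qed.

Lemma zres_trunc (p : nat) (p_pr : prime p) (x : zpadic p_pr) k m :
  (k <= m)%N -> (zres x m %% p ^ k)%N = zres x k.
Proof.
elim: m => [|m IHm]; first by rewrite leqn0 => /eqP->; rewrite zres_mod.
rewrite leq_eqVlt ltnS => /orP[/eqP->|km]; first exact: zres_mod.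
by rewrite -(IHm km) -(zresP x m) modn_dvdm // dvdn_exp2l.
Qed.

Fact zpadic_nat_subproof (p n k : nat) :
  ((n %% p ^ k.+1) %% p ^ k = n %% p ^ k)%N.
Proof. by rewrite modn_dvdm // dvdn_exp2l. Qed.

Definition zpadic_nat (p : nat) (p_pr : prime p) (n : nat) : zpadic p_pr :=
  ZPadic p_pr (zpadic_nat_subproof p n).

Fact zpadic_add_subproof (p : nat) (p_pr : prime p) (x y : zpadic p_pr) k :
  (((zres x k.+1 + zres y k.+1) %% p ^ k.+1) %% p ^ k =
   (zres x k + zres y k) %% p ^ k)%N.
Proof. by rewrite zpadic_nat_subproof -modnDm !zresP. Qed.

Definition zpadic_add (p : nat) (p_pr : prime p) (x y : zpadic p_pr) :=
  ZPadic p_pr (zpadic_add_subproof x y).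

Fact zpadic_mul_subproof (p : nat) (p_pr : prime p) (x y : zpadic p_pr) k :
  (((zres x k.+1 * zres y k.+1) %% p ^ k.+1) %% p ^ k =
   (zres x k * zres y k) %% p ^ k)%N.
Proof. by rewrite zpadic_nat_subproof -modnMm !zresP. Qed.

Definition zpadic_mul (p : nat) (p_pr : prime p) (x y : zpadic p_pr) :=
  ZPadic p_pr (zpadic_mul_subproof x y).

(* The factor p ^ k - 1 represents -1 modulo p ^ k. *)
Fact zpadic_opp_subproof (p : nat) (p_pr : prime p) (x : zpadic p_pr) k :
  ((((p ^ k.+1).-1 * zres x k.+1) %% p ^ k.+1) %% p ^ k =
   ((p ^ k).-1 * zres x k) %% p ^ k)%N.
Proof.
rewrite zpadic_nat_subproof -modnMm zresP -(modnMml (p ^ k).-1).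
congr ((_ * _) %% _)%N.
have pk_gt0 m : (0 < p ^ m)%N by rewrite expn_gt0 prime_gt0.
have -> : (p ^ k.+1).-1 = ((p.-1) * p ^ k + (p ^ k).-1)%N.
  by rewrite expnS -{1}(prednK (prime_gt0 p_pr)) mulSn addnC -!subn1 addnBA.
by rewrite modnMDl.
Qed.

Definition zpadic_opp (p : nat) (p_pr : prime p) (x : zpadic p_pr) :=
  ZPadic p_pr (zpadic_opp_subproof x).

Fact zpadic_addA (p : nat) (p_pr : prime p) : associative (@zpadic_add p p_pr).
Proof. by move=> x y z; apply: zpadic_eq => k /=; rewrite modnDml modnDmr addnA. Qed.

Fact zpadic_addC (p : nat) (p_pr : prime p) : commutative (@zpadic_add p p_pr).
Proof. by move=> x y; apply: zpadic_eq => k /=; rewrite addnC. Qed.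

Fact zpadic_add0 (p : nat) (p_pr : prime p) :
  left_id (zpadic_nat p_pr 0) (@zpadic_add p p_pr).
Proof. by move=> x; apply: zpadic_eq => k /=; rewrite mod0n zres_mod. Qed.

Fact zpadic_addN (p : nat) (p_pr : prime p) :
  left_inverse (zpadic_nat p_pr 0) (@zpadic_opp p p_pr) (@zpadic_add p p_pr).
Proof.
move=> x; apply: zpadic_eq => k /=.
by rewrite modnDml addnC -mulSn prednK ?expn_gt0 ?prime_gt0 // modnMr mod0n.
Qed.

HB.instance Definition _ (p : nat) (p_pr : prime p) :=
  GRing.isZmodule.Build (zpadic p_pr) (@zpadic_addA p p_pr)
    (@zpadic_addC p p_pr) (@zpadic_add0 p p_pr) (@zpadic_addN p p_pr).

Fact zpadic_mulA (p : nat) (p_pr : prime p) : associative (@zpadic_mul p p_pr).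
Proof. by move=> x y z; apply: zpadic_eq => k /=; rewrite modnMml modnMmr mulnA. Qed.

Fact zpadic_mulC (p : nat) (p_pr : prime p) : commutative (@zpadic_mul p p_pr).
Proof. by move=> x y; apply: zpadic_eq => k /=; rewrite mulnC. Qed.

Fact zpadic_mul1 (p : nat) (p_pr : prime p) :
  left_id (zpadic_nat p_pr 1) (@zpadic_mul p p_pr).
Proof. by move=> x; apply: zpadic_eq => k /=; rewrite modnMml mul1n zres_mod. Qed.

Fact zpadic_mulD (p : nat) (p_pr : prime p) :
  left_distributive (@zpadic_mul p p_pr) (@zpadic_add p p_pr).
Proof.
by move=> x y z; apply: zpadic_eq => k /=; rewrite modnMml modnDm mulnDl.
Qed.

Fact zpadic_1neq0 (p : nat) (p_pr : prime p) :
  zpadic_nat p_pr 1 != zpadic_nat p_pr 0.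
Proof.
apply/eqP => /(congr1 (fun x => zres x 1)) /=.
by rewrite mod0n modn_small // expn1 prime_gt1.
Qed.

HB.instance Definition _ (p : nat) (p_pr : prime p) :=
  GRing.Zmodule_isComNzRing.Build (zpadic p_pr) (@zpadic_mulA p p_pr)
    (@zpadic_mulC p p_pr) (@zpadic_mul1 p p_pr) (@zpadic_mulD p p_pr)
    (@zpadic_1neq0 p p_pr).

Definition zpadic_unit (p : nat) (p_pr : prime p) : pred (zpadic p_pr) :=
  fun x => `[< exists y, y * x = 1 >].

Definition zpadic_inv (p : nat) (p_pr : prime p) (x : zpadic p_pr) :
  zpadic p_pr := xget x [set y | y * x = 1]%classic.

Fact zpadic_mulV (p : nat) (p_pr : prime p) :
  {in @zpadic_unit p p_pr, left_inverse 1 (@zpadic_inv p p_pr) *%R}.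
Proof.
move=> x /asboolP[y yx]; rewrite /zpadic_inv; case: xgetP => [z _ //|no_inv].
by case: (no_inv y).
Qed.

Fact zpadic_unitP (p : nat) (p_pr : prime p) (x y : zpadic p_pr) :
  y * x = 1 -> @zpadic_unit p p_pr x.
Proof. by move=> yx; apply/asboolP; exists y. Qed.

Fact zpadic_inv_out (p : nat) (p_pr : prime p) :
  {in [predC @zpadic_unit p p_pr], @zpadic_inv p p_pr =1 id}.
Proof.
move=> x /negP nux; rewrite /zpadic_inv; case: xgetP => // y _ yx.
by case: nux; exact: zpadic_unitP yx.
Qed.

HB.instance Definition _ (p : nat) (p_pr : prime p) :=
  GRing.ComNzRing_hasMulInverse.Build (zpadic p_pr) (@zpadic_mulV p p_pr)
    (@zpadic_unitP p p_pr) (@zpadic_inv_out p p_pr).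

Fact zpadic_integral (p : nat) (p_pr : prime p) (x y : zpadic p_pr) :
  x * y = 0 -> (x == 0) || (y == 0).
Proof.
have nz (z : zpadic p_pr) : z != 0 -> exists k, zres z k != 0%N.
  move=> z0; apply: contrapT => /forallNP zk; case/eqP: z0.
  by apply: zpadic_eq => k /=; rewrite mod0n; apply/eqP/negPn/negP/zk.
move=> xy0; apply/norP => -[/nz[k xk] /nz[l yl]].
have := congr1 (fun z => zres z (k + l)%N) xy0 => /=; rewrite mod0n.
have lgE (z : zpadic p_pr) i j : zres z i != 0%N ->
    (0 < zres z (i + j))%N /\ (logn p (zres z (i + j)) < i)%N.
  rewrite -(zres_trunc z (leq_addr j i)) => zi.
  have z_gt0 : (0 < zres z (i + j))%N.
    by rewrite lt0n; apply: contraNneq zi => ->; rewrite mod0n.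
  by split=> //; rewrite ltnNge -pfactor_dvdn.
have [x0 xl] := lgE x k l xk; have [] := lgE y l k yl; rewrite addnC => y0 yk.
move/eqP; rewrite -/(dvdn _ _) pfactor_dvdn ?muln_gt0 ?x0 // lognM //.
by rewrite leqNgt -addSn leq_add // ltnW.
Qed.

HB.instance Definition _ (p : nat) (p_pr : prime p) :=
  GRing.ComUnitRing_isIntegral.Build (zpadic p_pr) (@zpadic_integral p p_pr).

Definition qpadic (p : nat) (p_pr : prime p) : fieldType :=
  {fraction zpadic p_pr}.

Definition zpadic_to_qpadic (p : nat) (p_pr : prime p) (x : zpadic p_pr) :
  qpadic p_pr := FracField.tofrac x.

(* zres (u n) k = zres l k says that p ^ k divides u n - l, i.e. that the p-adic
   absolute value of u n - l is at most p ^ (-k). *)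
Definition zpadic_cvg (p : nat) (p_pr : prime p) (u : nat -> zpadic p_pr)
    (l : zpadic p_pr) : Prop :=
  forall k, exists N, forall n, (N <= n)%N -> zres (u n) k = zres l k.

Definition pgamma_nat (p : nat) (p_pr : prime p) (n : nat) : zpadic p_pr :=
  (-1) ^+ n * \prod_(1 <= j < n | ~~ (p %| j)%N) j%:R.

(* The value at x != 0 is the common limit of the pgamma_nat (u i), for all
   sequences u of positive integers approaching x. That limit exists and is
   unique for odd p; the default 1 is then never used. *)
Definition pgamma (p : nat) (p_pr : prime p) (x : zpadic p_pr) : zpadic p_pr :=
  if x == 0 then 1 else
  xget 1 [set y : zpadic p_pr | forall u : nat -> nat,
            (forall i, (0 < u i)%N) ->
            zpadic_cvg (fun i => (u i)%:R) x ->
            zpadic_cvg (fun i => pgamma_nat p_pr (u i)) y]%classic.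

(* For a != 0, the unique (p-1)-th root of unity in Z_p congruent to a
   modulo p. *)
Definition teichmuller (p : nat) (p_pr : prime p) (a : 'F_p) : zpadic p_pr :=
  xget 0 [set w : zpadic p_pr |
            w ^+ p.-1 = 1 /\ (zres w 1)%:R = a]%classic.

(* The character omega^(-m), extended by 0 at 0, also when it is trivial. *)
Definition teichmuller_bar_exp (p : nat) (p_pr : prime p) (m : nat) (t : 'F_p) :
  zpadic p_pr := if t == 0 then 0 else (teichmuller p_pr t)^-1 ^+ m.

Definition quad_char (p : nat) (x : 'F_p) : int :=
  if x == 0 then 0 else if [exists y : 'F_p, y ^+ 2 == x] then 1 else -1.

Definition fracpart (x : rat) : rat := x - (Num.floor x)%:~R.

(* Gamma_p at a rational number of Z_p, with value in Q_p. Since Z_p is a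
   unitRingType, ratr is the inclusion of Q :&: Z_p in Z_p; it is meaningless
   on the rationals whose denominator is divisible by p. *)
Definition pgamma_rat (p : nat) (p_pr : prime p) (x : rat) : qpadic p_pr :=
  zpadic_to_qpadic (pgamma (ratr x : zpadic p_pr)).

(* Meant for 0 < n and parameters whose denominators are prime to p. *)
Definition mccarthy_G (p : nat) (p_pr : prime p) (n : nat)
    (a b : n.-tuple rat) (t : 'F_p) : qpadic p_pr :=
  - 1 / (p.-1)%:R *
  \sum_(0 <= m < p.-1)
    (let r : rat := m%:R / (p.-1)%:R in
     (-1) ^+ (m * n) * zpadic_to_qpadic (teichmuller_bar_exp p_pr m t) *
     \prod_(k < n)
       ((- (p%:R : qpadic p_pr)) ^
          (- Num.floor (fracpart (tnth a k) - r)
           - Num.floor (fracpart (- tnth b k) + r)) *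
        (pgamma_rat p_pr (fracpart (tnth a k - r)) /
         pgamma_rat p_pr (fracpart (tnth a k))) *
        (pgamma_rat p_pr (fracpart (- tnth b k + r)) /
         pgamma_rat p_pr (fracpart (- tnth b k))))).

(* Main.v *)
From HB Require Import structures.
Require Import Defs.
From mathcomp Require Import all_boot all_order all_algebra.
From mathcomp Require Import boolp classical_sets.
From mathcomp Require Import cyclic finfield ring zify.

Set Implicit Arguments.
Unset Strict Implicit.
Unset Printing Implicit Defensive.

Import Order.TTheory GRing.Theory Num.Theory.
Local Open Scope ring_scope.

(** Let phi be the quadratic character, N(t) the sum of phi(x^3 - 3x + 2 - 4t)
    over all x, and G the hypergeometric function of the theorem. Replacing x
    by -x and t by 1 - t changes the sign of the cubic, so that
    N(1 - t) = phi(-1) N(t): this is the twist by -1 relating two elliptic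
    curves. The theorem follows from the evaluation G(1/t) = - phi(3) N(t)
    ([mccarthy_cubic_sum]), which holds coefficient by coefficient on the
    multiplicative characters of t.

    Because x^3 - 3x + 2 = (x - 1)^2 (x + 2), the m-th Fourier coefficient of N
    is, up to elementary factors and a correction at the quadratic character, a
    product of two Jacobi sums ([cubic_coefE]). The Gross-Koblitz formula
    for Jacobi sums ([jacobi_pgamma]) writes them with values of Gamma_p at
    rationals of denominator p - 1, and the reflection, duplication and
    triplication formulas for Gamma_p turn the result into the m-th term of G
    ([cubic_coef_mccarthy]). These three formulas are elementary: both sides
    obey the same functional equation and are continuous.

    The Gross-Koblitz formula is proved inside Z_p, without Gauss sums. Let w be
    a (p - 1)-th root of unity. The series exp(u (T + T^p / p)) for u = 1, w and
    1 + w are linked by the addition law of the exponential. Put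
    T^(p - 1) = - p and collect the degrees congruent to c modulo p - 1. The
    k-th coefficient so obtained is a diagonal entry, in the basis of the binomials
    C(m, k), of the operator which sends g to f(m) g(p m + c), where
    f(m) = u^((p - 1) m + c) (- p)^m m! / (p m + c)! is continuous in the p-adic
    topology when u is a unit. The sum of the coefficients is the trace of that
    operator, which is the value of f at the fixed point m = - c / (p - 1),
    divided by 1 - p ([trace_formula], [dterm_sum]). That value is omega(u)^c Gamma_p(c / (p - 1)); for
    u = 1 + w, averaging against a power of w produces a Jacobi sum, while
    the addition law produces a product of two values of Gamma_p. *)

(** * Divisibility by powers of p in Z_p *)

Section Congruences.
Variables (p : nat) (p_pr : prime p).
Local Notation Z := (zpadic p_pr).
Implicit Types (x y z : Z) (N M k n : nat).

Lemma zresD x y k : zres (x + y) k = ((zres x k + zres y k) %% p ^ k)%N.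
Proof. by []. Qed.

Lemma zresM x y k : zres (x * y) k = ((zres x k * zres y k) %% p ^ k)%N.
Proof. by []. Qed.

Lemma zres_nat n k : zres (n%:R : Z) k = (n %% p ^ k)%N.
Proof.
elim: n => [|n IHn]; first by rewrite mod0n /= mod0n.
by rewrite -natr1 zresD IHn /= modnDm addn1.
Qed.

(** A congruence modulo p ^ N is written pdvd N (x - y); taking differences lets
    the closure properties of an ideal do the estimates. *)
Definition pdvd N x := zres x N == 0%N.

Lemma expp_gt0 k : (0 < p ^ k)%N.
Proof. by rewrite expn_gt0 prime_gt0. Qed.

Lemma pdvdP N x : reflect (exists y, x = p%:R ^+ N * y) (pdvd N x).
Proof.
apply: (iffP eqP) => [x0|[y ->]]; last first.
  by rewrite -natrX zresM zres_nat modnn mul0n mod0n.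
have dvdx k : (p ^ N %| zres x (N + k))%N.
  by rewrite /dvdn zres_trunc ?leq_addr // x0.
have yP k : ((zres x (N + k.+1) %/ p ^ N) %% p ^ k = zres x (N + k) %/ p ^ N)%N.
  rewrite -(@zres_trunc p p_pr x (N + k) (N + k.+1)) ?leq_add2l //.
  by rewrite modn_divl -expnD (addnC k).
exists (ZPadic p_pr yP); apply: zpadic_eq => k; rewrite -natrX zresM zres_nat /=.
by rewrite modnMml muln_divA // mulKn ?expp_gt0 // zres_trunc // leq_addl.
Qed.

Lemma pdvd0 N : pdvd N 0.
Proof. by apply/pdvdP; exists 0; rewrite mulr0. Qed.

Lemma pdvdM M N x y : pdvd M x -> pdvd N y -> pdvd (M + N) (x * y).
Proof.
move=> /pdvdP[a ->] /pdvdP[b ->]; apply/pdvdP; exists (a * b).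
by rewrite exprD mulrACA.
Qed.

Lemma pdvd_zero x : pdvd 0 x.
Proof. by apply/pdvdP; exists x; rewrite mul1r. Qed.

Lemma pdvdMl N x y : pdvd N y -> pdvd N (x * y).
Proof. exact: pdvdM (pdvd_zero x). Qed.

Lemma pdvdMr N x y : pdvd N x -> pdvd N (x * y).
Proof. by rewrite mulrC; exact: pdvdMl. Qed.

Lemma pdvdD N x y : pdvd N x -> pdvd N y -> pdvd N (x + y).
Proof.
move=> /pdvdP[a ->] /pdvdP[b ->]; apply/pdvdP; exists (a + b).
by rewrite mulrDr.
Qed.

Lemma pdvdN N x : pdvd N (- x) = pdvd N x.
Proof.
by apply/idP/idP => /(pdvdMl (-1)); rewrite mulN1r ?opprK.
Qed.

Lemma pdvdB N x y : pdvd N x -> pdvd N y -> pdvd N (x - y).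
Proof. by move=> ? ?; rewrite pdvdD ?pdvdN. Qed.

Lemma pdvd_subC N x y : pdvd N (x - y) = pdvd N (y - x).
Proof. by rewrite -pdvdN opprB. Qed.

Lemma pdvd_trans N x y z : pdvd N (x - y) -> pdvd N (y - z) -> pdvd N (x - z).
Proof. by move=> xy /(pdvdD xy); rewrite addrA subrK. Qed.

Lemma pdvd_sum N (I : Type) (r : seq I) (P : pred I) (F : I -> Z) :
  (forall i, P i -> pdvd N (F i)) -> pdvd N (\sum_(i <- r | P i) F i).
Proof. by move=> FP; elim/big_ind: _ => //; [exact: pdvd0 | exact: pdvdD]. Qed.

Lemma pdvdW M N x : (M <= N)%N -> pdvd N x -> pdvd M x.
Proof.
move=> MN /pdvdP[y ->]; rewrite -(subnK MN) addnC exprD -mulrA.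
by apply/pdvdP; eexists.
Qed.

Lemma pdvd_nat N n : pdvd N n%:R = (p ^ N %| n)%N.
Proof. by rewrite /pdvd zres_nat. Qed.

Lemma pdvd_eq0 x : (forall N, pdvd N x) -> x = 0.
Proof.
move=> x0; apply: zpadic_eq => k.
by rewrite (eqP (x0 k)) -[0]/(0%:R) zres_nat mod0n.
Qed.

Lemma pdvd_eq x y : (forall N, pdvd N (x - y)) -> x = y.
Proof. by move=> /pdvd_eq0/eqP; rewrite subr_eq0 => /eqP. Qed.

Lemma eq_zres N x y : zres x N = zres y N <-> pdvd N (x - y).
Proof.
split=> [xy|/pdvdP[a]]; last first.
  move/eqP; rewrite subr_eq addrC => /eqP->.
  by rewrite zresD -natrX zresM zres_nat modnn mul0n mod0n addn0 zres_mod.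
rewrite /pdvd zresD /= xy modnDmr -mulSn prednK ?expp_gt0 //.
by rewrite modnMr.
Qed.

Lemma pdvd_zres N x : pdvd N (x - (zres x N)%:R).
Proof. by apply/eq_zres; rewrite zres_nat zres_mod. Qed.

Lemma pdvdBM N x y x' y' :
  pdvd N (x - x') -> pdvd N (y - y') -> pdvd N (x * y - x' * y').
Proof.
move=> xx yy; have -> : x * y - x' * y' = (x - x') * y + x' * (y - y') by ring.
by apply: pdvdD; [exact: pdvdMr | exact: pdvdMl].
Qed.

Lemma pdvdBD N x y x' y' :
  pdvd N (x - x') -> pdvd N (y - y') -> pdvd N ((x + y) - (x' + y')).
Proof.
move=> xx yy; have -> : (x + y) - (x' + y') = (x - x') + (y - y') by ring.
by rewrite pdvdD.
Qed.

Lemma pdvd_refl N x : pdvd N (x - x).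
Proof. by rewrite subrr pdvd0. Qed.

Lemma pdvdBX N x y n : pdvd N (x - y) -> pdvd N (x ^+ n - y ^+ n).
Proof. by move=> xy; rewrite subrXX pdvdMr. Qed.

Lemma pdvdB_prod N (I : Type) (r : seq I) (P : pred I) (F G : I -> Z) :
  (forall i, P i -> pdvd N (F i - G i)) ->
  pdvd N (\prod_(i <- r | P i) F i - \prod_(i <- r | P i) G i).
Proof.
move=> FG; elim/big_ind2: _ => // [|x x' y y']; first exact: pdvd_refl.
exact: pdvdBM.
Qed.

Lemma pdvdB_sum N (I : Type) (r : seq I) (P : pred I) (F G : I -> Z) :
  (forall i, P i -> pdvd N (F i - G i)) ->
  pdvd N (\sum_(i <- r | P i) F i - \sum_(i <- r | P i) G i).
Proof. by move=> FG; rewrite -sumrB; exact: pdvd_sum. Qed.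

Lemma zpadic_natr_eq0 n : ((n%:R : Z) == 0) = (n == 0%N).
Proof.
apply/eqP/eqP => [n0|->//]; apply/eqP; rewrite -leqn0 leqNgt; apply/negP => n_gt0.
have := pdvd0 n; rewrite -n0 pdvd_nat => /dvdn_leq; rewrite n_gt0 => /(_ isT).
by rewrite leqNgt ltn_expl // prime_gt1.
Qed.

Lemma pnat_neq0 : (p%:R : Z) != 0.
Proof. by rewrite zpadic_natr_eq0 -lt0n prime_gt0. Qed.

Lemma pdvd_pmul N x : pdvd N.+1 (p%:R * x) = pdvd N x.
Proof.
apply/idP/idP => [/pdvdP[y]|]; last first.
  by apply: (@pdvdM 1); rewrite pdvd_nat expn1.
rewrite exprS -mulrA => /(mulfI pnat_neq0) ->; apply/pdvdP; by exists y.
Qed.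

Lemma pdvd_pXmul M N x : pdvd (M + N) (p%:R ^+ M * x) = pdvd N x.
Proof. by elim: M => [|M IHM]; rewrite ?mul1r // exprS -mulrA addSn pdvd_pmul. Qed.

(** A residue prime to p is invertible modulo every power of p, and uniqueness
    makes these inverses compatible. *)
Lemma zpadic_unitE x : (x \is a GRing.unit) = ~~ pdvd 1 x.
Proof.
apply/idP/idP => [ux|nx].
  apply/negP => /(pdvdMl x^-1); rewrite mulVr //.
  by rewrite -[1]/(1%:R) pdvd_nat dvdn1 expn1 => /eqP p1; move: p_pr; rewrite p1.
have cop k : coprime (zres x k.+1) (p ^ k.+1).
  rewrite coprime_pexpr // coprime_sym prime_coprime //.
  by rewrite /dvdn -{2}(expn1 p) zres_trunc.
have inv k : exists b : nat,
    (b < p ^ k)%N /\ ((zres x k * b) %% p ^ k = 1 %% p ^ k)%N.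
  case: k => [|k]; first by exists 0%N; rewrite expn0 !modn1.
  exists ((zres x k.+1 ^ (totient (p ^ k.+1)).-1) %% p ^ k.+1)%N.
  rewrite ltn_pmod ?expp_gt0 //; split=> //.
  rewrite modnMmr -expnS prednK ?totient_gt0 ?expp_gt0 //.
  exact: Euler_exp_totient.
have invU k a b c : (b < p ^ k)%N -> (c < p ^ k)%N ->
    (a * b = 1 %[mod p ^ k])%N -> (a * c = 1 %[mod p ^ k])%N -> b = c.
  move=> bk ck ab ac; rewrite -(modn_small bk) -(modn_small ck).
  rewrite -[in LHS](muln1 b) -modnMmr -ac modnMmr.
  by rewrite mulnA (mulnC b) -modnMml ab modnMml mul1n.
have [y yP] := choice inv.
have yC k : (y k.+1 %% p ^ k = y k)%N.
  have [yk1 xy1] := yP k.+1; have [yk xy] := yP k.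
  apply: (invU k (zres x k)) => //; first by rewrite ltn_pmod ?expp_gt0.
  rewrite -(zresP x) modnMml modnMmr.
  have dk : (p ^ k %| p ^ k.+1)%N by rewrite dvdn_exp2l.
  by rewrite -(modn_dvdm _ dk) xy1 modn_dvdm.
apply/unitrP; exists (ZPadic p_pr yC).
have e : x * ZPadic p_pr yC = 1.
  by apply: zpadic_eq => k; rewrite zresM /=; case: (yP k).
by rewrite e mulrC e.
Qed.

Lemma zpadic_nat_unit n : ((n%:R : Z) \is a GRing.unit) = ~~ (p %| n)%N.
Proof. by rewrite zpadic_unitE pdvd_nat expn1. Qed.

(** Cancelling y costs a bounded precision: y is a unit times some p ^ M. *)
Lemma pdvd_cancel y : y != 0 ->
  exists M, forall N x, pdvd (M + N) (y * x) -> pdvd N x.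
Proof.
move=> y0.
have [M [yM yM1]] : exists M, pdvd M y /\ ~~ pdvd M.+1 y.
  apply: contrapT => h; case/eqP: y0; apply: pdvd_eq0; elim=> [|N IHN].
    exact: pdvd_zero.
  by apply: contrapT => /negP yN; apply: h; exists N.
exists M => N x; have /pdvdP[u yu] := yM.
have uu : u \is a GRing.unit.
  by rewrite zpadic_unitE; move: yM1; rewrite yu -[M.+1]addn1 pdvd_pXmul.
rewrite yu -mulrA pdvd_pXmul => /(pdvdMl u^-1).
by rewrite mulKr.
Qed.

Lemma pdvd_unit_cancel N u x : u \is a GRing.unit -> pdvd N (u * x) = pdvd N x.
Proof.
move=> uu; apply/idP/idP => [|/(pdvdMl u)//].
by move/(pdvdMl u^-1); rewrite mulKr.
Qed.

Lemma pdvdB_inv N u v : u \is a GRing.unit -> v \is a GRing.unit ->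
  pdvd N (u - v) -> pdvd N (u^-1 - v^-1).
Proof.
move=> uu uv; have -> : u^-1 - v^-1 = - (u^-1 * v^-1 * (u - v)).
  by rewrite mulrBr mulrAC mulVr // mulrVK // mul1r opprB.
by rewrite pdvdN; exact: pdvdMl.
Qed.

(** The quotient of x ^ p - y ^ p by x - y is a sum of p terms, each congruent
    to y ^ (p - 1) modulo p. *)
Lemma pdvdB_expp N x y : (0 < N)%N -> pdvd N (x - y) ->
  pdvd N.+1 (x ^+ p - y ^+ p).
Proof.
move=> N_gt0 xy; rewrite subrXX -addn1; apply: pdvdM => //.
have xy1 : pdvd 1 (x - y) by exact: pdvdW xy.
have -> : \sum_(i < p) x ^+ (p.-1 - i) * y ^+ i =
   \sum_(i < p) (x ^+ (p.-1 - i) - y ^+ (p.-1 - i)) * y ^+ i +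
   p%:R * y ^+ p.-1.
  rewrite mulr_natl -[X in _ *+ X]card_ord -sumr_const -big_split /=.
  apply: eq_bigr => i _; rewrite mulrBl -exprD subnK ?subrK //.
  by rewrite -ltnS prednK ?prime_gt0.
apply: pdvdD; last by rewrite pdvdMr // pdvd_nat expn1.
by apply: pdvd_sum => i _; rewrite pdvdMr // pdvdBX.
Qed.

Lemma pdvdB_exppX N x y : pdvd 1 (x - y) ->
  pdvd N.+1 (x ^+ (p ^ N) - y ^+ (p ^ N)).
Proof.
move=> xy; elim: N => [|N IHN]; first by rewrite expn0 !expr1.
by rewrite expnSr !exprM; exact: pdvdB_expp.
Qed.

End Congruences.

(** * Finite differences *)

Section FiniteDifferences.
Variable R : comNzRingType.
Implicit Types (f g : nat -> R) (m n k : nat).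

Definition fdiff f : nat -> R := fun m => f m.+1 - f m.

Lemma eq_iter_fdiff n f g m : f =1 g -> iter n fdiff f m = iter n fdiff g m.
Proof. by move=> /funext->. Qed.

Lemma iter_fdiffS n f m :
  iter n.+1 fdiff f m = iter n fdiff f m.+1 - iter n fdiff f m.
Proof. by []. Qed.

Lemma iter_fdiff_sum (I : Type) (r : seq I) (P : pred I) (F : I -> nat -> R)
    (c : I -> R) n m :
  iter n fdiff (fun m => \sum_(i <- r | P i) c i * F i m) m =
  \sum_(i <- r | P i) c i * iter n fdiff (F i) m.
Proof.
elim: n m => [//|n IHn] m; rewrite iter_fdiffS !IHn -sumrB.
by apply: eq_bigr => i _; rewrite iter_fdiffS mulrBr.
Qed.

Lemma iter_fdiffD n f g m :
  iter n fdiff (fun m => f m + g m) m = iter n fdiff f m + iter n fdiff g m.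
Proof.
by elim: n m => [//|n IHn] m; rewrite !iter_fdiffS !IHn opprD addrACA.
Qed.

Lemma iter_fdiffZ n c f m :
  iter n fdiff (fun m => c * f m) m = c * iter n fdiff f m.
Proof. by elim: n m => [//|n IHn] m; rewrite !iter_fdiffS !IHn mulrBr. Qed.

Lemma iter_fdiffM n f m :
  iter n fdiff (fun m => m%:R * f m) m =
  m%:R * iter n fdiff f m + n%:R * iter n.-1 fdiff f m.+1.
Proof.
elim: n m => [|n IHn] m; first by rewrite mul0r addr0.
rewrite !iter_fdiffS !IHn /=; case: n IHn => [|n] _ /=.
  by rewrite /fdiff /= -!natr1; ring.
by rewrite -/(iter n fdiff) /fdiff -!natr1; ring.
Qed.

Lemma newton_forward f m n :
  f (m + n)%N = \sum_(i < n.+1) 'C(n, i)%:R * iter i fdiff f m.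
Proof.
elim: n m => [|n IHn] m; first by rewrite big_ord1 bin0 mul1r addn0.
have -> : f (m + n.+1)%N = f (m + n)%N + fdiff f (m + n)%N.
  by rewrite /fdiff addnS addrC subrK.
rewrite (IHn m).
have -> : fdiff f (m + n)%N =
    \sum_(i < n.+1) 'C(n, i)%:R * iter i.+1 fdiff f m.
  rewrite /fdiff -addSn !IHn -sumrB; apply: eq_bigr => i _.
  by rewrite iter_fdiffS mulrBr.
rewrite [in RHS]big_ord_recl [in LHS]big_ord_recl /= !bin0 -addrA; congr (_ + _).
rewrite [X in _ = X](eq_bigr (fun i : 'I_n.+1 =>
   'C(n, i.+1)%:R * iter i.+1 fdiff f m + 'C(n, i)%:R * iter i.+1 fdiff f m));
  last by move=> i _; rewrite /bump add1n binS natrD mulrDl.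
by rewrite big_split /= [in RHS]big_ord_recr /= bin_small // mul0r addr0.
Qed.

Lemma iter_fdiff_ends q f m : iter q.+1 fdiff f m =
  f (m + q.+1)%N - f m - \sum_(i < q) 'C(q.+1, i.+1)%:R * iter i.+1 fdiff f m.
Proof.
rewrite (newton_forward f m q.+1) big_ord_recl big_ord_recr /= bin0 binn !mul1r.
by rewrite [f m + _]addrC addrK addrC addrK.
Qed.

Lemma iter_fdiffE n f m : iter n fdiff f m =
  \sum_(i < n.+1) (-1) ^+ (n - i) * 'C(n, i)%:R * f (m + i)%N.
Proof.
elim: n m => [|n IHn] m; first by rewrite big_ord1 bin0 !mul1r addn0.
rewrite iter_fdiffS !IHn [in RHS]big_ord_recl /= bin0 subn0 addn0 mulr1.
rewrite [in RHS](eq_bigr (fun i : 'I_n.+1 =>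
   (-1) ^+ (n - i) * 'C(n, i)%:R * f (m.+1 + i)%N +
   (-1) ^+ (n - i) * 'C(n, i.+1)%:R * f (m + i.+1)%N)); last first.
  move=> i _; rewrite /bump add1n addSnnS binS natrD subSS; ring.
rewrite big_split /= addrCA; congr (_ + _).
rewrite big_ord_recl [in RHS]big_ord_recr /= bin0 subn0 addn0 mulr1.
rewrite bin_small // mulr0 mul0r addr0 opprD exprS mulN1r mulNr; congr (_ + _).
rewrite -sumrN; apply: eq_bigr => i _.
by rewrite /bump add1n -(subnSK (ltn_ord i)) exprS; ring.
Qed.

End FiniteDifferences.

(** * The trace formula *)

Section TraceFormula.
Variables (p : nat) (p_pr : prime p).
Local Notation Z := (zpadic p_pr).
Implicit Types (f : nat -> Z) (N M K k n m a : nat).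

Lemma pdvd_iter_fdiff N f n m :
  (forall m, pdvd N (f m)) -> pdvd N (iter n (@fdiff Z) f m).
Proof. by move=> fN; elim: n m => [//|n IHn] m; rewrite iter_fdiffS pdvdB. Qed.

Lemma dvdn_bin_expp M i : (0 < i < p ^ M)%N -> (p %| 'C(p ^ M, i))%N.
Proof.
case: i => // i /= iM; rewrite -[(p %| _)%N]negbK -prime_coprime //.
apply/negP => cop.
have e := mul_bin_diag (p ^ M) i.
have : (p ^ M %| i.+1 * 'C(p ^ M, i.+1))%N by rewrite -e dvdn_mulr.
rewrite Gauss_dvdl ?coprimeXl // => /(dvdn_leq (ltn0Sn i)).
by rewrite leqNgt iM.
Qed.

(** Mahler's theorem, quantitatively. With q = p ^ M, the q-th difference of g is
    g (m + q) - g m up to terms with a coefficient C(q, i), 0 < i < q, divisible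
    by p; so q further differences gain a factor p, until p ^ N is reached. *)
Lemma pdvd_iter_fdiff_periodic N M f :
  (forall m, pdvd N (f (m + p ^ M)%N - f m)) ->
  forall j m, (p ^ M * N <= j)%N -> pdvd N (iter j (@fdiff Z) f m).
Proof.
move=> fM; have q_gt0 := expp_gt0 p_pr M; set q := (p ^ M)%N in fM q_gt0 *.
have main n m : pdvd (minn n N) (iter (n * q) (@fdiff Z) f m).
  elim: n m => [|n IHn] m; first by rewrite min0n pdvd_zero.
  rewrite mulSn iterD; set g := iter (n * q) _ f in IHn *.
  rewrite -{1}(prednK q_gt0) iter_fdiff_ends prednK //; apply: pdvdB.
    have -> : g (m + q)%N - g m =
        iter (n * q) (@fdiff Z) (fun m => f (m + q)%N + -1 * f m) m.
      rewrite iter_fdiffD iter_fdiffZ mulN1r; congr (_ - _).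
      rewrite /g; elim: (n * q)%N m => [//|k IHk] m.
      by rewrite !iter_fdiffS -!IHk addSn.
    apply: pdvdW (geq_minr _ _) _; apply: pdvd_iter_fdiff => k.
    by rewrite mulN1r.
  apply: pdvd_sum => i _; apply: (@pdvdW _ _ _ (1 + minn n N)).
    by rewrite add1n; lia.
  apply: pdvdM; last exact: (@pdvd_iter_fdiff _ g).
  rewrite pdvd_nat expn1 dvdn_bin_expp //= -/q.
  by rewrite -[X in (_ < X)%N]prednK // ltnS.
move=> j m jN; rewrite -(subnK jN) iterD mulnC.
by apply: pdvd_iter_fdiff => k; have := main N k; rewrite minnn.
Qed.

Lemma binDp b k m : 'C(p * m.+1 + b, k)%:R =
  \sum_(l < k.+1) 'C(p, l)%:R * 'C(p * m + b, k - l)%:R :> Z.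
Proof.
rewrite mulnS -addnA -binomial.Vandermonde natr_sum.
by apply: eq_bigr => l _; rewrite natrM.
Qed.

Lemma fdiff_bin_mulp b k m :
  fdiff (fun m => 'C(p * m + b, k)%:R : Z) m =
  \sum_(l < k) 'C(p, l.+1)%:R * 'C(p * m + b, k - l.+1)%:R.
Proof.
rewrite /fdiff binDp big_ord_recl bin0 mul1r subn0 addrC addKr.
by apply: eq_bigr => l _.
Qed.

(** By Vandermonde, a difference in m lowers k by some l at the price of the
    factor C(p, l), which is divisible by p unless l = p; the latter can happen
    at most k / p times. *)
Lemma pdvd_iter_fdiff_bin b k n m :
  pdvd (n - k %/ p) (iter n (@fdiff Z) (fun m => 'C(p * m + b, k)%:R) m).
Proof.
elim: n k m => [|n IHn] k m; first by rewrite sub0n pdvd_zero.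
rewrite iterSr (eq_iter_fdiff _ _ (fdiff_bin_mulp b k)) iter_fdiff_sum.
apply: pdvd_sum => l _; have p_gt0 := prime_gt0 p_pr.
case: (ltngtP l.+1 p) => lp.
- apply: (@pdvdW _ _ _ (1 + (n - (k - l.+1) %/ p))).
    have : ((k - l.+1) %/ p <= k %/ p)%N by rewrite leq_div2r // leq_subr.
    by lia.
  by apply: pdvdM => //; rewrite pdvd_nat expn1 prime_dvd_bin.
- by rewrite bin_small // mul0r pdvd0.
- rewrite lp binn mul1r; apply: (pdvdW _ (IHn _ _)).
  have pk : (p <= k)%N by rewrite -lp.
  by rewrite -{1}(subnK pk) divnDr ?dvdnn // divnn p_gt0; lia.
Qed.

Lemma iter_fdiff_bin b k n m : (k <= n)%N ->
  iter n (@fdiff Z) (fun m => 'C(p * m + b, k)%:R) m =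
  if k == n then p%:R ^+ n else 0.
Proof.
elim: n k m => [|n IHn] k m; first by rewrite leqn0 => /eqP->; rewrite /= bin0.
move=> kn; rewrite iterSr (eq_iter_fdiff _ _ (fdiff_bin_mulp b k)) iter_fdiff_sum.
case: k kn => [|k] kn; first by rewrite big_ord0.
rewrite ltnS in kn; rewrite big_ord_recl bin1 subn1 /= IHn // eqSS.
rewrite big1 ?addr0 => [|i _]; first by case: eqP => _; rewrite ?mulr0 ?exprS.
rewrite IHn /bump /=; last by lia.
by rewrite ifN ?mulr0 //; have := ltn_ord i; lia.
Qed.

(** The operator sending g to the function f m * g (p * m + a) has these diagonal
    entries in the basis of the binomials C(m, k): the coefficient of C(m, k) in
    a function is its k-th difference at 0. *)
Definition trterm a f k :=
  iter k (@fdiff Z) (fun m => 'C(p * m + a, k)%:R * f m) 0.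

Definition trsum a f K := \sum_(k < K.+1) trterm a f k.

Lemma trtermE a f k : trterm a f k =
  \sum_(i < k.+1) (-1) ^+ (k - i) * 'C(k, i)%:R * ('C(p * i + a, k)%:R * f i).
Proof. by rewrite /trterm iter_fdiffE. Qed.

Lemma trsum_comb (I : Type) (r : seq I) (P : pred I) (F : I -> nat -> Z)
    (c : I -> Z) a K :
  trsum a (fun m => \sum_(i <- r | P i) c i * F i m) K =
  \sum_(i <- r | P i) c i * trsum a (F i) K.
Proof.
rewrite /trsum; under [RHS]eq_bigr => i _ do rewrite mulr_sumr.
rewrite [RHS]exchange_big; apply: eq_bigr => k _; rewrite /trterm /=.
rewrite -iter_fdiff_sum; apply: eq_iter_fdiff => m; rewrite mulr_sumr.
by apply: eq_bigr => i _; rewrite mulrCA.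
Qed.

Lemma trsumD a f g K :
  trsum a (fun m => f m + g m) K = trsum a f K + trsum a g K.
Proof.
rewrite /trsum -big_split; apply: eq_bigr => k _ /=; rewrite /trterm.
by rewrite -iter_fdiffD; apply: eq_iter_fdiff => m; rewrite mulrDr.
Qed.

Lemma trsumZ a c f K : trsum a (fun m => c * f m) K = c * trsum a f K.
Proof.
rewrite /trsum mulr_sumr; apply: eq_bigr => k _ /=; rewrite /trterm.
by rewrite -iter_fdiffZ; apply: eq_iter_fdiff => m; rewrite mulrCA.
Qed.

Lemma pdvd_trsum N a f K : (forall m, pdvd N (f m)) -> pdvd N (trsum a f K).
Proof.
move=> fN; apply: pdvd_sum => k _; apply: pdvd_iter_fdiff => m.
exact: pdvdMl.
Qed.

Lemma eq_trsum a f g K : f =1 g -> trsum a f K = trsum a g K.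
Proof. by move=> /funext->. Qed.

Lemma trsum1 a K : trsum a (fun=> 1) K = \sum_(k < K.+1) p%:R ^+ k.
Proof.
apply: eq_bigr => k _; rewrite /trterm.
rewrite (@eq_iter_fdiff _ _ _ (fun m => 'C(p * m + a, k)%:R)); last first.
  by move=> m; rewrite mulr1.
by rewrite iter_fdiff_bin // eqxx.
Qed.

(** The factor (p - 1) m + a vanishes at the fixed point of m |-> p m + a. With
    n = p m + a it equals n - m, and
    (n - m) C(n, k) = (k + 1) C(n, k + 1) - (m - k) C(n, k);
    the k-th difference at 0 of (m - k) C(n, k) g m is k times the difference of
    order k - 1 of C(n, k) g m, whence the telescoping. *)
Lemma trsum_telescope a g K :
  trsum a (fun m => (p.-1 * m + a)%:R * g m) K =
  K.+1%:R * iter K (@fdiff Z) (fun m => 'C(p * m + a, K.+1)%:R * g m) 0.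
Proof.
have p_gt0 := prime_gt0 p_pr.
have step k : trterm a (fun m => (p.-1 * m + a)%:R * g m) k =
   k.+1%:R * iter k (@fdiff Z) (fun m => 'C(p * m + a, k.+1)%:R * g m) 0 -
   k%:R * iter k.-1 (@fdiff Z) (fun m => 'C(p * m + a, k)%:R * g m) 0.
  have E m : 'C(p * m + a, k)%:R * ((p.-1 * m + a)%:R * g m) =
    k.+1%:R * ('C(p * m + a, k.+1)%:R * g m) + (k%:R * ('C(p * m + a, k)%:R * g m) +
      -1 * (m%:R * ('C(p * m + a, k)%:R * g m))) :> Z.
    have -> : (p.-1 * m + a)%:R = (p * m + a)%:R - m%:R :> Z.
      have -> : (p * m + a = p.-1 * m + a + m)%N.
        by rewrite -{1}(prednK p_gt0) mulSn; lia.
      by rewrite [in RHS]natrD addrK.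
    have := mul_bin_left (p * m + a) k => /(congr1 (fun n => n%:R : Z)).
    rewrite !natrM [k.+1%:R * (_ * _)]mulrA => ->; case: (leqP k (p * m + a)) => kn.
      by rewrite natrB //; ring.
    by rewrite bin_small //; ring.
  rewrite /trterm (eq_iter_fdiff _ _ E) !iter_fdiffD !iter_fdiffZ iter_fdiffM.
  rewrite mul0r add0r; case: k {E} => [|k] /=; first by ring.
  by rewrite /fdiff; ring.
rewrite /trsum; under eq_bigr => k _ do rewrite step.
elim: K => [|K IHK]; first by rewrite big_ord1 /=; ring.
by rewrite big_ord_recr /= IHK; ring.
Qed.

Lemma pdvd_iter_fdiff_ffact j a k n m : pdvd (n - (k %/ p + j))
  (iter n (@fdiff Z) (fun m => 'C(p * m + a, k)%:R * (m ^_ j)%:R) m).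
Proof.
elim: j n m => [|j IHj] n m.
  rewrite addn0 (@eq_iter_fdiff _ _ _ (fun m => 'C(p * m + a, k)%:R)).
    exact: pdvd_iter_fdiff_bin.
  by move=> i; rewrite mulr1.
pose g i := 'C(p * i + a, k)%:R * (i ^_ j)%:R : Z.
rewrite (@eq_iter_fdiff _ _ _ (fun i => i%:R * g i + - j%:R * g i)).
  rewrite iter_fdiffD iter_fdiffZ iter_fdiffM !pdvdD // pdvdMl //.
  - by apply: pdvdW (IHj _ _); lia.
  - by apply: pdvdW (IHj _ _); lia.
  - by apply: pdvdW (IHj _ _); lia.
move=> i; rewrite ffactnSr /g; case: (leqP j i) => ji.
  by rewrite natrM natrB //; ring.
by rewrite ffact_small //; ring.
Qed.

Section Approximations.
Variable a : nat.
Hypothesis p_gt2 : (2 < p)%N.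

Lemma pred_unit : (p.-1%:R : Z) \is a GRing.unit.
Proof.
have p_gt0 := prime_gt0 p_pr.
by rewrite zpadic_nat_unit gtnNdvd // ?prednK // -ltnS prednK //; lia.
Qed.

(** The trace of the operator attached to the falling factorial of order j is
    its value at the fixed point times the trace for the constant 1: the two
    sides satisfy the same recursion on j, obtained by multiplying by
    (p - 1) m + a. The integer s approximates the fixed point. *)
Lemma trsum_ffact j N : exists K0, forall K s, (K0 <= K)%N ->
  (p ^ N %| p.-1 * s + a)%N ->
  pdvd N (trsum a (fun m => (m ^_ j)%:R) K - (s ^_ j)%:R * trsum a (fun=> 1) K).
Proof.
elim: j => [|j [K0 IHj]].
  by exists 0%N => K s _ _; rewrite mul1r pdvd_refl.
exists (maxn K0 (2 * (N + j) + 2)) => K s; rewrite geq_max => /andP[K0K NK] sN.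
rewrite -(pdvd_unit_cancel _ _ pred_unit).
have := trsum_telescope a (fun m => (m ^_ j)%:R) K.
rewrite (@eq_trsum _ _ (fun m => p.-1%:R * (m ^_ j.+1)%:R +
    (p.-1 * j + a)%:R * (m ^_ j)%:R)); last first.
  move=> m; rewrite ffactnSr; case: (leqP j m) => jm.
    by rewrite !natrD !natrM natrB //; ring.
  by rewrite ffact_small //; ring.
rewrite trsumD !trsumZ => /eqP; rewrite -subr_eq0 => /eqP E.
have -> : p.-1%:R * (trsum a (fun m => (m ^_ j.+1)%:R) K -
      (s ^_ j.+1)%:R * trsum a (fun=> 1) K) =
   K.+1%:R * iter K (@fdiff Z)
     (fun m => 'C(p * m + a, K.+1)%:R * (m ^_ j)%:R) 0
   - (p.-1 * j + a)%:R * (trsum a (fun m => (m ^_ j)%:R) K -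
                           (s ^_ j)%:R * trsum a (fun=> 1) K)
   - (p.-1 * s + a)%:R * ((s ^_ j)%:R * trsum a (fun=> 1) K) :> Z.
  apply/eqP; rewrite -subr_eq0 -[X in _ == X]E; apply/eqP.
  rewrite ffactnSr; case: (leqP j s) => js.
    by rewrite !natrD !natrM natrB //; ring.
  by rewrite ffact_small //; ring.
apply: pdvdB; last by rewrite pdvdMr // pdvd_nat.
apply: pdvdB; last by rewrite pdvdMl // IHj.
rewrite pdvdMl //; apply: pdvdW (pdvd_iter_fdiff_ffact _ _ _ _ _).
have : (K.+1 %/ p <= K.+1 %/ 2)%N by rewrite leq_div2l //; lia.
by move: (K.+1 %/ p)%N => d; lia.
Qed.

Lemma trsum_bin j N : exists K0 M, forall K s, (K0 <= K)%N ->
  (p ^ M %| p.-1 * s + a)%N ->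
  pdvd N (trsum a (fun m => 'C(m, j)%:R) K - 'C(s, j)%:R * trsum a (fun=> 1) K).
Proof.
have j0 : (j`!%:R : Z) != 0 by rewrite zpadic_natr_eq0 -lt0n fact_gt0.
have [M MP] := pdvd_cancel j0; have [K0 K0P] := trsum_ffact j (M + N).
exists K0, (M + N)%N => K s KK sM; apply: MP; rewrite mulrBr -trsumZ mulrA.
rewrite -natrM mulnC bin_ffact (@eq_trsum _ _ (fun m => (m ^_ j)%:R)).
  exact: K0P.
by move=> m; rewrite -natrM mulnC bin_ffact.
Qed.

Lemma trsum_comb_bin (c : nat -> Z) J N : exists K0 M, forall K s, (K0 <= K)%N ->
  (p ^ M %| p.-1 * s + a)%N ->
  pdvd N (trsum a (fun m => \sum_(j < J) c j * 'C(m, j)%:R) K -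
          (\sum_(j < J) c j * 'C(s, j)%:R) * trsum a (fun=> 1) K).
Proof.
elim: J => [|J [K0 [M IHJ]]].
  exists 0%N, 0%N => K s _ _.
  by rewrite trsum_comb !big_ord0 mul0r pdvd_refl.
have [K1 [M1 J1]] := trsum_bin J N.
exists (maxn K0 K1), (maxn M M1) => K s; rewrite geq_max => /andP[KK0 KK1] sM.
rewrite trsum_comb !big_ord_recr /= -trsum_comb mulrDl.
apply: pdvdBD.
  by apply: IHJ => //; apply: dvdn_trans sM; rewrite dvdn_exp2l // leq_maxl.
rewrite -mulrA -mulrBr pdvdMl // J1 //.
by apply: dvdn_trans sM; rewrite dvdn_exp2l // leq_maxr.
Qed.

Lemma approx_fixpoint M : exists s, (p ^ M %| p.-1 * s + a)%N.
Proof.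
exists (a * \sum_(i < M) p ^ i)%N; rewrite mulnCA -predn_exp -mulnSr.
by rewrite prednK ?expp_gt0 // dvdn_mull.
Qed.

(** On the polynomial functions of u = m + a / (p - 1), the operator attached to
    f = 1 has the eigenvalues p ^ k, and multiplication by u raises the degree:
    only the value l of f at u = 0 contributes to the trace, which is
    l (1 + p + p ^ 2 + ...). A continuous f reduces to a combination of binomials
    modulo p ^ N, by Mahler's theorem. *)
Theorem trace_formula f l :
  (forall N, exists M, forall m, pdvd N (f (m + p ^ M)%N - f m)) ->
  (forall N, exists M, forall s, (p ^ M %| p.-1 * s + a)%N -> pdvd N (f s - l)) ->
  forall N, exists K0, forall K, (K0 <= K)%N ->
    pdvd N ((1 - p%:R) * trsum a f K - l).
Proof.
move=> fC fl N; have [M0 M0P] := fC N; have [M1 M1P] := fl N.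
set J := (p ^ M0 * N)%N; pose c j := iter j (@fdiff Z) f 0.
(* The Newton series of f at 0, truncated where its terms vanish modulo p ^ N *)
pose P m := \sum_(j < J) c j * 'C(m, j)%:R.
have fP m : pdvd N (f m - P m).
  have := newton_forward f 0 m; rewrite add0n => ->.
  have -> : \sum_(i < m.+1) 'C(m, i)%:R * iter i (@fdiff Z) f 0 =
            \sum_(i < m.+1 + J) c i * 'C(m, i)%:R.
    rewrite big_split_ord /= [X in _ + X]big1 ?addr0 => [|i _].
      by apply: eq_bigr => i _; rewrite mulrC.
    by rewrite bin_small ?mulr0 //; lia.
  rewrite [(m.+1 + J)%N]addnC big_split_ord /=.
  have -> : P m = \sum_(i < J) c (lshift m.+1 i) * 'C(m, lshift m.+1 i)%:R by [].
  rewrite addrAC subrr add0r.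
  apply: pdvd_sum => i _; rewrite pdvdMr //.
  by apply: pdvd_iter_fdiff_periodic M0P _ _ _; rewrite leq_addr.
have [K2 [M2 KMP]] := trsum_comb_bin c J N.
exists (maxn K2 N) => K; rewrite geq_max => /andP[KK NK].
have [s sM] := approx_fixpoint (maxn M1 M2).
have sM1 : (p ^ M1 %| p.-1 * s + a)%N.
  by apply: dvdn_trans sM; rewrite dvdn_exp2l // leq_maxl.
have sM2 : (p ^ M2 %| p.-1 * s + a)%N.
  by apply: dvdn_trans sM; rewrite dvdn_exp2l // leq_maxr.
have E1 : pdvd N (trsum a f K - trsum a P K).
  have -> : trsum a f K - trsum a P K = trsum a (fun m => f m + -1 * P m) K.
    by rewrite trsumD trsumZ mulN1r.
  by apply: pdvd_trsum => m; rewrite mulN1r.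
have E2 := KMP K s KK sM2; rewrite -/(P s) -/P in E2.
apply: pdvd_trans (M1P s sM1); rewrite pdvd_subC.
apply: (pdvd_trans (fP s)); rewrite pdvd_subC.
apply: (@pdvd_trans _ _ _ _ ((1 - p%:R) * (P s * trsum a (fun=> 1) K))).
  by rewrite -mulrBr pdvdMl //; apply: pdvd_trans E1 E2.
have geom : (1 - p%:R) * trsum a (fun=> 1) K = 1 - p%:R ^+ K.+1 :> Z.
  by rewrite trsum1 -[1 - p%:R]opprB mulNr -subrX1 opprB.
rewrite mulrCA geom mulrBr mulr1 addrAC subrr add0r pdvdN pdvdMl //.
apply: (@pdvdW _ _ _ K.+1); first exact: leqW.
by apply/pdvdP; exists 1; rewrite mulr1.
Qed.

End Approximations.
End TraceFormula.

(** * Teichmuller representatives *)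

Section Teichmuller.
Variables (p : nat) (p_pr : prime p).
Local Notation Z := (zpadic p_pr).
Implicit Types (x y w : Z) (a b : 'F_p).

Definition residue x : 'F_p := (zres x 1)%:R.

Lemma residue_nat n : residue (n%:R) = n%:R.
Proof. by rewrite /residue zres_nat expn1 Fp_nat_mod. Qed.

Lemma residueD x y : residue (x + y) = residue x + residue y.
Proof. by rewrite /residue zresD expn1 Fp_nat_mod // natrD. Qed.

Lemma residueM x y : residue (x * y) = residue x * residue y.
Proof. by rewrite /residue zresM expn1 Fp_nat_mod // natrM. Qed.

Lemma residue1 : residue 1 = 1.
Proof. exact: (residue_nat 1). Qed.

Lemma residueX x n : residue (x ^+ n) = residue x ^+ n.
Proof.
elim: n => [|n IHn]; first by rewrite residue1.
by rewrite !exprS residueM IHn.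
Qed.

Lemma residue_eq0 x : (residue x == 0) = pdvd 1 x.
Proof.
rewrite /residue -(dvdn_pcharf (pchar_Fp p_pr)) /pdvd -(zres_mod x 1) expn1.
by rewrite /dvdn modn_mod.
Qed.

Lemma residueN x : residue (- x) = - residue x.
Proof. by apply/eqP; rewrite -addr_eq0 -residueD addNr -[0]/(0%:R) residue_nat. Qed.

Lemma residue_eq x y : (residue x == residue y) = pdvd 1 (x - y).
Proof. by rewrite -subr_eq0 -residueN -residueD residue_eq0. Qed.

Lemma residue_onto a : exists n : nat, a = n%:R.
Proof. by exists a; rewrite natr_Zp. Qed.

Lemma pdvd_Fermat x : ~~ pdvd 1 x -> pdvd 1 (x ^+ p.-1 - 1).
Proof.
move=> x0; rewrite -residue_eq residueX residue1.
have : residue x != 0 by rewrite residue_eq0.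
move: (residue x) => a a0; apply/eqP; apply: (mulfI a0).
rewrite -exprS prednK ?prime_gt0 // mulr1.
by have := expf_card a; rewrite card_Fp.
Qed.

Lemma rootunity_expp w k : w ^+ p.-1 = 1 -> w ^+ (p ^ k) = w.
Proof.
move=> w1; elim: k => [|k IHk]; first by rewrite expr1.
by rewrite expnSr exprM IHk -[X in w ^+ X](prednK (prime_gt0 p_pr)) exprS w1 mulr1.
Qed.

Lemma rootunity_inj w w' : w ^+ p.-1 = 1 -> w' ^+ p.-1 = 1 ->
  pdvd 1 (w - w') -> w = w'.
Proof.
move=> w1 w1' ww; apply: pdvd_eq => -[|N]; first exact: pdvd_zero.
rewrite -(rootunity_expp N w1) -(rootunity_expp N w1').
exact: pdvdB_exppX.
Qed.

(** The Teichmuller representative of n is the limit of the powers n ^ (p ^ k). *)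
Lemma rootunity_exists n : ~~ (p %| n)%N ->
  exists w, w ^+ p.-1 = 1 /\ pdvd 1 (w - n%:R).
Proof.
move=> pn; have n1 : pdvd 1 ((n ^ p.-1)%N%:R - 1 : Z).
  by rewrite natrX pdvd_Fermat // pdvd_nat expn1.
have p_gt0 := prime_gt0 p_pr.
have stepP k : pdvd k.+1 ((n ^ (p ^ k.+1))%N%:R - (n ^ (p ^ k))%N%:R : Z).
  have -> : (p ^ k.+1 = p.-1 * p ^ k + p ^ k)%N.
    by rewrite -mulSnr prednK // expnS.
  rewrite expnD natrM -[X in _ - X]mul1r -mulrBl pdvdMr //.
  by rewrite expnM natrX; have := pdvdB_exppX k n1; rewrite expr1n.
have wP k : ((n ^ (p ^ k.+1) %% p ^ k.+1) %% p ^ k = n ^ (p ^ k) %% p ^ k)%N.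
  rewrite modn_dvdm ?dvdn_exp2l // -!(zres_nat p_pr).
  by apply/eq_zres; exact: pdvdW (stepP k).
have wE N : pdvd N (ZPadic p_pr wP - (n ^ (p ^ N))%N%:R).
  by apply/eq_zres; rewrite zres_nat.
exists (ZPadic p_pr wP); split.
  apply: pdvd_eq => N; apply: pdvd_trans (pdvdBX _ (wE N)) _.
  rewrite -natrX -expnM mulnC expnM natrX.
  by have := pdvdB_exppX N n1; rewrite expr1n; apply: pdvdW.
apply: pdvd_trans (wE 1) _.
by have := stepP 0; rewrite expn0 !expn1.
Qed.

Local Notation teich := (teichmuller p_pr).

Lemma teichP a : a != 0 -> teich a ^+ p.-1 = 1 /\ residue (teich a) = a.
Proof.
move=> a0; rewrite /teichmuller; case: xgetP => [w _ //|noW].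
have [n an] := residue_onto a.
have [|w [w1 wn]] := @rootunity_exists n.
  by rewrite (dvdn_pcharf (pchar_Fp p_pr)) -an.
case: (noW w); split => //; rewrite -/(residue w) an -(residue_nat n); apply/eqP.
by rewrite residue_eq.
Qed.

Lemma teich_exp a : a != 0 -> teich a ^+ p.-1 = 1.
Proof. by move/teichP=> []. Qed.

Lemma residue_teich a : a != 0 -> residue (teich a) = a.
Proof. by move/teichP=> []. Qed.

Lemma teich_unit a : a != 0 -> teich a \is a GRing.unit.
Proof. by move=> a0; rewrite zpadic_unitE -residue_eq0 residue_teich. Qed.

Lemma teich_uniq a w : a != 0 -> w ^+ p.-1 = 1 -> residue w = a -> teich a = w.
Proof.
move=> a0 w1 wa; apply: rootunity_inj => //; first exact: teich_exp.
by rewrite -residue_eq residue_teich // wa.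
Qed.

Lemma teichM a b : a != 0 -> b != 0 -> teich (a * b) = teich a * teich b.
Proof.
move=> a0 b0; apply: teich_uniq; first by rewrite mulf_neq0.
  by rewrite exprMn !teich_exp // mulr1.
by rewrite residueM !residue_teich.
Qed.

Lemma teich1 : teich 1 = 1.
Proof.
by apply: teich_uniq; rewrite ?oner_eq0 ?expr1n // residue1.
Qed.

Lemma teichN1 : (2 < p)%N -> teich (-1) = -1.
Proof.
move=> p_gt2; apply: teich_uniq; rewrite ?oppr_eq0 ?oner_eq0 //.
  have [p2|podd] := even_prime p_pr; first by rewrite p2 in p_gt2.
  by rewrite -signr_odd -subn1 oddB ?prime_gt0 // podd.
by rewrite residueN residue1.
Qed.

Lemma teichV a : a != 0 -> teich a^-1 = (teich a)^-1.
Proof.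
move=> a0; apply: (mulrI (teich_unit a0)).
by rewrite -teichM ?invr_eq0 // divff // teich1 divrr // teich_unit.
Qed.

Lemma teich_expM a k l : a != 0 -> (k = l %[mod p.-1])%N ->
  teich a ^+ k = teich a ^+ l.
Proof.
move=> a0 kl; rewrite -(expr_mod k (teich_exp a0)) kl.
by rewrite (expr_mod l (teich_exp a0)).
Qed.

End Teichmuller.

Section TeichmullerCharacters.
Variables (p : nat) (p_pr : prime p).
Local Notation Z := (zpadic p_pr).
Local Notation teich := (teichmuller p_pr).

Lemma sum_teich m : \sum_(x : 'F_p | x != 0) teich x ^+ m =
  if (p.-1 %| m)%N then p.-1%:R else 0.
Proof.
have p_gt0 := prime_gt0 p_pr.
case: ifPn => [/dvdnP[d ->]|pm].
  rewrite (eq_bigr (fun=> 1)); last first.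
    by move=> x x0; rewrite mulnC exprM teich_exp // expr1n.
  by rewrite sumr_const; congr (_%:R); rewrite cardC1 card_Fp.
have [y y0 ym] : exists2 y : 'F_p, y != 0 & y ^+ m != 1.
  apply: contrapT => no; pose r := (m %% p.-1)%N.
  have r_gt0 : (0 < r)%N by rewrite lt0n.
  have rt : all r.-unity_root (enum (predC1 (0 : 'F_p))).
    apply/allP => x; rewrite mem_enum => x0; rewrite unity_rootE.
    have x1 : x ^+ p.-1 = 1.
      by rewrite -(residue_teich p_pr x0) -residueX teich_exp // residue1.
    rewrite expr_mod //; apply/negPn/negP => xm; apply: no; by exists x.
  have := max_unity_roots r_gt0 rt (enum_uniq _).
  rewrite -cardE cardC1 card_Fp // leqNgt ltn_mod.
  by case/negP; have := prime_gt1 p_pr; lia.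
set S := \sum_(_ | _) _.
have SE : S = teich y ^+ m * S.
  rewrite {1}/S (reindex_inj (mulfI y0)) /= mulr_sumr.
  rewrite (eq_bigl (fun x : 'F_p => x != 0)).
    by apply: eq_bigr => x x0; rewrite teichM // exprMn.
  by move=> x; rewrite mulf_eq0 (negPf y0).
apply/eqP; have : (1 - teich y ^+ m) * S == 0 by rewrite mulrBl mul1r -SE subrr.
rewrite mulf_eq0 => /orP[/eqP h|//]; case/negP: ym; apply/eqP.
rewrite -{1}(residue_teich p_pr y0) -residueX.
by rewrite -[teich y ^+ m](subKr 1) h subr0 residue1.
Qed.

Definition teich_char k (x : 'F_p) : Z := if x == 0 then 0 else teich x ^+ k.

Lemma teich_charE x k : x != 0 -> teich_char k x = teich x ^+ k.
Proof. by rewrite /teich_char => /negPf->. Qed.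

End TeichmullerCharacters.

(** * The p-adic Gamma function *)

Section Gamma.
Variables (p : nat) (p_pr : prime p).
Hypothesis p_gt2 : (2 < p)%N.
Local Notation Z := (zpadic p_pr).
Local Notation gnat := (pgamma_nat p_pr).
Implicit Types (x y w : Z) (m n k N : nat).

Lemma p_odd : odd p.
Proof. by case: (even_prime p_pr) => // p2; move: p_gt2; rewrite p2. Qed.

Lemma pgamma_nat0 : gnat 0 = 1.
Proof. by rewrite /pgamma_nat big_geq // mulr1. Qed.

Lemma pgamma_natS n :
  gnat n.+1 = (if (p %| n)%N then -1 else - n%:R) * gnat n.
Proof.
rewrite /pgamma_nat exprS; case: n => [|n].
  by rewrite dvdn0 !big_geq // !mulr1.
rewrite big_mkcond big_nat_recr //= -big_mkcond /=.
by case: (p %| n.+1)%N => /=; rewrite ?exprS; ring.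
Qed.

Lemma pgamma_nat_unit n : gnat n \is a GRing.unit.
Proof.
elim: n => [|n IHn]; first by rewrite pgamma_nat0 unitr1.
rewrite pgamma_natS unitrM IHn andbT; case: ifPn => pn; first by rewrite unitrN1.
by rewrite unitrN zpadic_nat_unit.
Qed.

(** Expanding the product to first order in y is enough, since y ^ 2 vanishes
    modulo p ^ (k + 1) for y = p ^ k. *)
Lemma prod_shift_first_order N y (I : Type) (r : seq I) (P : pred I) (c : I -> Z) :
  pdvd N (y * y) -> exists B, forall i : nat,
    pdvd N (\prod_(j <- r | P j) (c j + i%:R * y) -
            (\prod_(j <- r | P j) c j + i%:R * y * B)).
Proof.
move=> yy; elim: r => [|j r [B IHr]].
  by exists 0 => i; rewrite !big_nil mulr0 addr0 pdvd_refl.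
exists (if P j then c j * B + \prod_(j <- r | P j) c j else B) => i.
rewrite !big_cons; case: (P j) => //.
set A := \prod_(_ <- _ | _) c _ in IHr *.
set F := \prod_(_ <- _ | _) _ in IHr *.
have -> : (c j + i%:R * y) * F - (c j * A + i%:R * y * (c j * B + A)) =
   (c j + i%:R * y) * (F - (A + i%:R * y * B)) + i%:R * i%:R * B * (y * y).
  by ring.
by apply: pdvdD; apply: pdvdMl => //; exact: IHr.
Qed.

Lemma prod_shift_sum N y A B : pdvd N (y * y) -> forall n,
  pdvd N (\prod_(i < n.+1) (A + i%:R * y * B) -
          A ^+ n * (A + 'C(n.+1, 2)%:R * y * B)).
Proof.
move=> yy; elim=> [|n IHn].
  rewrite big_ord1 bin_small // expr0 !mul0r mul1r; exact: pdvd_refl.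
rewrite big_ord_recr /=; set F := \prod_(_ < _) _ in IHn *.
have -> : F * (A + n.+1%:R * y * B) -
   A ^+ n.+1 * (A + 'C(n.+2, 2)%:R * y * B) =
   (F - A ^+ n * (A + 'C(n.+1, 2)%:R * y * B)) * (A + n.+1%:R * y * B)
   + A ^+ n * 'C(n.+1, 2)%:R * n.+1%:R * B * B * (y * y).
  by rewrite (binS n.+1) bin1 natrD exprS; ring.
by apply: pdvdD; [exact: pdvdMr | exact: pdvdMl].
Qed.

Definition wprod k : Z := \prod_(0 <= j < p ^ k | ~~ (p %| j)%N) j%:R.

(** The integers below p ^ (k + 1) form p translates of those below p ^ k. The
    first-order terms have the total coefficient 0 + 1 + ... + (p - 1), which is
    divisible by p. *)
Lemma wprodS k : (0 < k)%N -> pdvd k.+1 (wprod k.+1 - wprod k ^+ p).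
Proof.
move=> k_gt0; set y : Z := (p ^ k)%N%:R.
have yy : pdvd k.+1 (y * y).
  by rewrite -natrM pdvd_nat -expnD dvdn_exp2l //; lia.
pose blk i := \prod_(0 <= j < p ^ k | ~~ (p %| j)%N) (j%:R + i%:R * y).
have split_blk n : \prod_(0 <= j < n * p ^ k | ~~ (p %| j)%N) (j%:R : Z) =
    \prod_(i < n) blk i.
  elim: n => [|n IHn]; first by rewrite big_geq // big_ord0.
  rewrite big_ord_recr /= -IHn (@big_cat_nat _ _ _ (n * p ^ k)) //=; last first.
    by rewrite leq_mul2r leqnSn orbT.
  congr (_ * _); rewrite -{1}[(n * p ^ k)%N]add0n big_addn mulSn addnK.
  apply: eq_big => [j|j _]; last by rewrite natrD natrM.
  by rewrite dvdn_addl // dvdn_mull // dvdn_exp.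
have [B BP] := prod_shift_first_order (index_iota 0 (p ^ k))
   (fun j => ~~ (p %| j)%N) (fun j => j%:R) yy.
rewrite {1}/wprod expnS split_blk.
apply: pdvd_trans (pdvdB_prod _ (fun (i : 'I_p) _ => BP i)) _.
rewrite -/(wprod k); have p_gt0 := prime_gt0 p_pr.
have := prod_shift_sum (wprod k) B yy p.-1; rewrite prednK // => main.
apply: (pdvd_trans main); rewrite mulrDr -exprSr prednK // addrAC subrr add0r.
rewrite pdvdMl // pdvdMr // -natrM pdvd_nat expnSr mulnC dvdn_mul //.
by rewrite bin2odd ?p_odd // dvdn_mulr.
Qed.

(** Wilson's theorem modulo p ^ k; by the previous lemma each power of p costs
    one p-th power, and (-1) ^ p = -1. *)
Lemma wprodN1 k : (0 < k)%N -> pdvd k (wprod k + 1).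
Proof.
elim: k => // -[_ _|k IHk _].
  have p_gt0 := prime_gt0 p_pr.
  have -> : wprod 1 = ((p.-1)`!)%:R.
    rewrite /wprod expn1 fact_prod natr_prod prednK // big_ltn_cond // dvdn0 /=.
    rewrite [LHS]big_nat_cond [RHS]big_nat_cond; apply: eq_bigl => j.
    by case: (ltnP 0 j) => //= j0; case: (ltnP j p) => //= jp; rewrite gtnNdvd.
  rewrite natr1 pdvd_nat expn1 -Wilson //; exact: prime_gt1.
have := pdvdB_expp (ltn0Sn k) (_ : pdvd k.+1 (wprod k.+1 - -1)).
rewrite opprK => /(_ (IHk isT)); rewrite -signr_odd p_odd expr1 opprK => h.
have := wprodS (ltn0Sn k) => h2.
by have := pdvdD h2 h; rewrite addrA subrK.
Qed.

Lemma pgamma_nat_expp k : pdvd k (gnat (p ^ k) - 1).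
Proof.
case: k => [|k]; first exact: pdvd_zero.
have -> : gnat (p ^ k.+1) = - wprod k.+1.
  rewrite /pgamma_nat -signr_odd oddX p_odd orbT expr1 mulN1r; congr (- _).
  rewrite /wprod [in RHS]big_ltn_cond ?expp_gt0 // dvdn0 /=.
  by [].
by rewrite -opprD pdvdN wprodN1.
Qed.

Lemma pgamma_natDexpp k n : pdvd k (gnat (n + p ^ k) - gnat n).
Proof.
case: k => [|k]; first exact: pdvd_zero.
elim: n => [|n IHn]; first by rewrite add0n pgamma_nat0 pgamma_nat_expp.
rewrite addSn !pgamma_natS; apply: pdvdBM => //.
have pk : (p %| p ^ k.+1)%N by rewrite dvdn_exp.
rewrite dvdn_addl //; case: ifP => _; first exact: pdvd_refl.
by rewrite opprK addrC natrD opprD addrA subrr sub0r pdvdN pdvd_nat.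
Qed.

Lemma pgamma_nat_cong k m n : pdvd k (m%:R - n%:R : Z) ->
  pdvd k (gnat m - gnat n).
Proof.
wlog le_nm : m n / (n <= m)%N.
  move=> h; case/orP: (leq_total m n) => mn; last exact: h.
  by move=> H; rewrite pdvd_subC; apply: h mn _; rewrite pdvd_subC.
rewrite -natrB // pdvd_nat => /dvdnP[d mn].
rewrite -(subnK le_nm) mn addnC.
elim: d {m le_nm mn} => [|d IHd]; first by rewrite addn0 pdvd_refl.
rewrite mulSn [(p ^ k + _)%N]addnC addnA; apply: pdvd_trans IHd.
exact: pgamma_natDexpp.
Qed.

(** The congruences between the values at integers show that the limit defining
    pgamma x exists; at x = 0 it is 1, in accordance with the special case of the
    definition. *)
Lemma pgamma_approx x N n : pdvd N (x - n%:R) -> pdvd N (pgamma x - gnat n).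
Proof.
have GP k : (zres (gnat (zres x k.+1)) k.+1 %% p ^ k = zres (gnat (zres x k)) k)%N.
  rewrite zresP; apply/eq_zres/pgamma_nat_cong/eq_zres.
  by rewrite !zres_nat zresP zres_mod.
pose G := ZPadic p_pr GP.
have GE k m : pdvd k (x - m%:R) -> pdvd k (G - gnat m).
  move=> xm; apply: (@pdvd_trans _ _ _ _ (gnat (zres x k))).
    exact/eq_zres.
  apply: pgamma_nat_cong; apply: pdvd_trans xm; rewrite pdvd_subC.
  exact: pdvd_zres.
suff -> : pgamma x = G by exact: GE.
rewrite /pgamma; case: eqP => [x0|_].
  apply: pdvd_eq => k; rewrite pdvd_subC -pgamma_nat0; apply: GE.
  by rewrite x0 pdvd_refl.
have Gin (u : nat -> nat) : zpadic_cvg (fun i => (u i)%:R) x ->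
    zpadic_cvg (fun i => gnat (u i)) G.
  move=> ux k; have [M MP] := ux k; exists M => m Mm.
  apply/eq_zres; rewrite pdvd_subC; apply: GE; rewrite pdvd_subC.
  by apply/eq_zres; exact: MP.
case: xgetP => [y _ yP|/(_ G)[]]; last by move=> u _; exact: Gin.
(* Adding p ^ i keeps these approximations of x positive. *)
pose u i := (zres x i + p ^ i)%N.
have ux : zpadic_cvg (fun i => (u i)%:R) x.
  move=> k; exists k => m km; rewrite zres_nat /u -modnDmr.
  have /eqP -> : (p ^ k %| p ^ m)%N by rewrite dvdn_exp2l.
  by rewrite addn0 zres_trunc.
have u0 i : (0 < u i)%N by rewrite addn_gt0 expp_gt0 // orbT.
apply: zpadic_eq => k; have [M MP] := yP u u0 ux k; have [L LP] := Gin u ux k.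
by rewrite -(MP (maxn M L)) ?leq_maxl // LP // leq_maxr.
Qed.

Lemma pgamma_natr n : pgamma (n%:R : Z) = gnat n.
Proof. by apply: pdvd_eq => N; apply: pgamma_approx; exact: pdvd_refl. Qed.

Lemma pgamma0 : pgamma (0 : Z) = 1.
Proof. by rewrite -[0]/(0%:R) pgamma_natr pgamma_nat0. Qed.

Lemma pgamma_cont N x y : pdvd N (x - y) -> pdvd N (pgamma x - pgamma y).
Proof.
move=> xy; have xn := pdvd_zres N x.
apply: (pdvd_trans (pgamma_approx xn)); rewrite pdvd_subC.
by apply: pgamma_approx; apply: pdvd_trans xn; rewrite pdvd_subC.
Qed.

Lemma pgammaS x : pgamma (x + 1) = (if pdvd 1 x then -1 else - x) * pgamma x.
Proof.
apply: pdvd_eq => N; have xn := pdvd_zres N.+1 x; set n := zres x N.+1 in xn.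
have x1n : pdvd N.+1 (x + 1 - n.+1%:R).
  by rewrite -natr1 opprD addrACA subrr addr0.
apply: (@pdvdW _ _ _ N.+1) => //; apply: (pdvd_trans (pgamma_approx x1n)).
rewrite pgamma_natS; apply: pdvdBM; last first.
  by rewrite pdvd_subC; exact: pgamma_approx.
have -> : pdvd 1 x = (p %| n)%N.
  have x1 : pdvd 1 (x - n%:R) by apply: pdvdW xn.
  rewrite -[p in RHS]expn1 -(pdvd_nat p_pr).
  apply/idP/idP => [xd|nd]; last by rewrite -(subrK n%:R x) pdvdD.
  by rewrite -[n%:R](subKr x) pdvdB.
case: ifP => _; first exact: pdvd_refl.
by rewrite -opprD pdvdN pdvd_subC.
Qed.

Lemma pgamma_unit x : pgamma x \is a GRing.unit.
Proof.
have h : pdvd 1 (pgamma x - gnat (zres x 1)) := pgamma_approx (pdvd_zres 1 x).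
rewrite zpadic_unitE; apply/negP => /pdvdB /(_ h); rewrite opprB addrC subrK.
by apply/negP; rewrite -zpadic_unitE pgamma_nat_unit.
Qed.

End Gamma.

(** * Gamma at the rationals of denominator p - 1 *)

Section GammaAtRationals.
Variables (p : nat) (p_pr : prime p).
Hypothesis p_gt2 : (2 < p)%N.
Local Notation Z := (zpadic p_pr).
Local Notation teich := (teichmuller p_pr).
Implicit Types (x y w r : Z) (m n k N b : nat).

Let pred_natr_unit := pred_unit p_pr p_gt2.

Lemma pdvd_natr_pred N m n :
  (p ^ N %| p.-1 * n + m)%N -> pdvd N (n%:R + m%:R / p.-1%:R : Z).
Proof.
move=> h; rewrite -(pdvd_unit_cancel _ _ pred_natr_unit) mulrDr mulrCA.
by rewrite divrr ?pred_natr_unit // mulr1 -natrM -natrD pdvd_nat.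
Qed.

(** The point r = b / (p - 1) is the limit of the positive integers
    1 + (p - 1 - b) (1 + p + ... + p ^ (N - 1)), and f is computed there by
    counting the integers prime to p that precede them. *)
Lemma quasi_periodic_at_rational (f : Z -> Z) kappa w b r :
  (forall N x y, pdvd N (x - y) -> pdvd N (f x - f y)) ->
  (forall x, f (x + 1) = (if pdvd 1 x then 1 else kappa) * f x) ->
  w ^+ p.-1 = 1 -> pdvd 1 (kappa - w) -> (b < p)%N -> p.-1%:R * r = b%:R ->
  f r = w ^+ (p.-1 - b) * f 0.
Proof.
move=> fC fS w1 kw bp rE; have p_gt0 := prime_gt0 p_pr.
have fnS n : f n.+1%:R = (if (p %| n)%N then 1 else kappa) * f n%:R.
  by rewrite -natr1 fS pdvd_nat expn1.
have fblk m d : (d < p)%N -> f (p * m + d.+1)%N%:R = kappa ^+ d * f (p * m)%N%:R.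
  elim: d => [_|d IHd dp]; first by rewrite addn1 fnS dvdn_mulr // expr0.
  rewrite addnS fnS IHd; last exact: ltnW.
  rewrite dvdn_addr ?dvdn_mulr // gtnNdvd // exprS.
  by rewrite mulrA.
have fmul m : f (p * m)%N%:R = kappa ^+ (p.-1 * m) * f 0.
  elim: m => [|m IHm]; first by rewrite !muln0 mul1r.
  have -> : (p * m.+1 = p * m + p.-1.+1)%N by rewrite prednK // mulnS addnC.
  by rewrite fblk ?prednK // IHm mulrA -exprD mulnS.
pose c := (p.-1 - b)%N; pose v N := (c * \sum_(i < N) p ^ i)%N.
have vS N : v N.+1 = (p * v N + c)%N.
  rewrite /v big_ord_recl expn0 mulnDr muln1 addnC; congr (_ + _)%N.
  rewrite mulnCA; congr (_ * _)%N; rewrite big_distrr /=.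
  by apply: eq_bigr => i _; rewrite -expnS.
have vE N : (p.-1 * v N = c * (p ^ N).-1)%N by rewrite /v mulnCA -predn_exp.
have cp : (c < p)%N by rewrite /c; lia.
apply: pdvd_eq => N; apply: (@pdvdW _ _ _ N.+1) => //.
apply: (@pdvd_trans _ _ _ _ (f (v N.+1).+1%:R)).
  apply: fC; rewrite -(pdvd_unit_cancel _ _ pred_natr_unit) mulrBr rE -natrM.
  rewrite mulnS vE pdvd_subC.
  have -> : (p.-1 + c * (p ^ N.+1).-1 = b + c * p ^ N.+1)%N.
    have := expp_gt0 p_pr N.+1; rewrite -{3}(prednK (expp_gt0 p_pr N.+1)) mulnS.
    by rewrite /c; lia.
  by rewrite natrD addrC addKr pdvd_nat dvdn_mull.
rewrite vS -addnS fblk // fmul mulrA -exprD vE -mulnS prednK ?expp_gt0 //.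
rewrite -mulrBl pdvdMr // mulnC exprM -/c -[in w ^+ c](rootunity_expp N w1).
by apply: pdvdBX; exact: pdvdB_exppX.
Qed.

Definition grat b : Z := pgamma (b%:R / p.-1%:R).

Lemma pred_mul_div b : p.-1%:R * (b%:R / p.-1%:R) = b%:R :> Z.
Proof. by rewrite mulrC divrK // pred_natr_unit. Qed.

Lemma grat0 : grat 0 = 1.
Proof. by rewrite /grat mul0r pgamma0. Qed.

Lemma grat_unit b : grat b \is a GRing.unit.
Proof. exact: pgamma_unit. Qed.

(** The function Gamma x * Gamma (1 - x) changes sign between x and x + 1 when x
    is a unit, and keeps its value otherwise. *)
Lemma grat_reflection b : (b < p)%N ->
  grat b * grat (p.-1 - b) = - (-1) ^+ b.
Proof.
move=> bp; pose f x := pgamma x * pgamma (1 - x).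
have r1 : (p.-1 - b)%:R / p.-1%:R = 1 - b%:R / p.-1%:R :> Z.
  by rewrite natrB ?mulrBl ?divrr ?pred_natr_unit //; lia.
rewrite /grat r1 -/(f _).
rewrite (@quasi_periodic_at_rational f (-1) (-1) b); first last.
- exact: pred_mul_div.
- by [].
- exact: pdvd_refl.
- by rewrite -signr_odd -subn1 oddB ?prime_gt0 // p_odd.
- move=> x; have -> : f (x + 1) = pgamma (x + 1) * pgamma (- x).
    by rewrite /f opprD addrCA subrr addr0.
  rewrite {}/f pgammaS // (addrC 1) (pgammaS _ (- x)) // pdvdN.
  by case: ifP => _; ring.
- move=> N x y xy; apply: pdvdBM; apply: pgamma_cont => //.
  have -> : 1 - x - (1 - y) = y - x by ring.
  by rewrite pdvd_subC.
rewrite /f pgamma0 // subr0 -[X in _ * pgamma X](add0r 1).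
rewrite pgammaS // pdvd0 pgamma0 //.
rewrite !mulr1 !mul1r mulrN1; congr (- _).
rewrite -[LHS]signr_odd oddB; last by lia.
by rewrite -subn1 oddB ?prime_gt0 // p_odd //= signr_odd.
Qed.

(** The quotient of the left-hand side by Gamma x, as a function of
    x = b / (p - 1), is divided by m between x and x + 1 when x is a unit, and
    keeps its value otherwise. *)
Lemma grat_multiplication m b : (0 < m)%N -> ~~ (p %| m)%N -> (b < p)%N ->
  \prod_(h < m) pgamma ((b%:R / p.-1%:R + h%:R) / m%:R : Z) =
  teich m%:R ^+ b * \prod_(h < m) pgamma (h%:R / m%:R : Z) * grat b.
Proof.
move=> m0 pm bp; have mu : (m%:R : Z) \is a GRing.unit by rewrite zpadic_nat_unit.
have mF : (m%:R : 'F_p) != 0 by rewrite -(dvdn_pcharf (pchar_Fp p_pr)).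
pose g x := \prod_(h < m) pgamma ((x + h%:R) / m%:R : Z).
pose f x := g x / pgamma x.
rewrite -/(g _) -[LHS](divrK (grat_unit b)) -/(f _); congr (_ * _).
have tu := teich_unit p_pr mF.
rewrite (@quasi_periodic_at_rational f (m%:R^-1) (teich m%:R)^-1 b); first last.
- exact: pred_mul_div.
- by [].
- apply: pdvdB_inv => //; rewrite -residue_eq residue_nat residue_teich //.
- by rewrite exprVn teich_exp // invr1.
- move=> x; rewrite [LHS]/f.
  have -> : g (x + 1) = (if pdvd 1 x then -1 else - (x / m%:R)) * g x.
    have gS : g (x + 1) = \prod_(h < m) pgamma ((x + h.+1%:R) / m%:R : Z).
      by apply: eq_bigr => h _; rewrite -addrA [1 + _]addrC natr1.
    rewrite {}gS /g; case: m m0 mu {pm mF f g tu} => // m _ mu.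
    rewrite [in LHS]big_ord_recr [in RHS]big_ord_recl /=.
    rewrite addr0 [in RHS]mulrA [in RHS]mulrC; congr (_ * _).
    rewrite mulrDl divrr // pgammaS //; congr (_ * _).
    by rewrite [x / _]mulrC pdvd_unit_cancel ?unitrV.
  rewrite /f pgammaS //; case: ifPn => xu.
    by rewrite invrM ?unitrN1 ?pgamma_unit // invrN1 mulrN1 mulN1r mulrNN mul1r.
  rewrite -zpadic_unitE in xu.
  have uP := pgamma_unit p_gt2 x.
  apply: (@mulIr _ (- x * pgamma x)); first by rewrite unitrM unitrN xu.
  rewrite divrK; last by rewrite unitrM unitrN xu.
  by rewrite -{1}[g x](divrK uP); ring.
- move=> N x y xy; apply: pdvdBM; last first.
    by apply: pdvdB_inv; rewrite ?pgamma_unit //; exact: pgamma_cont.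
  apply: pdvdB_prod => h _; apply: pgamma_cont => //.
  by rewrite -mulrBl pdvdMr // opprD addrACA subrr addr0.
rewrite exprVn; congr (_ * _).
  apply: (mulIr (unitrX (p.-1 - b) tu)); rewrite mulVr ?unitrX // -exprD.
  by rewrite subnKC ?teich_exp //; lia.
rewrite /f pgamma0 // divr1; apply: eq_bigr => h _; by rewrite add0r.
Qed.

End GammaAtRationals.

(** * The series exp (u (T + T ^ p / p)) *)

Section DworkExponential.
Variables (F : fieldType) (p : nat).
Hypothesis char0 : forall n, (n.+1%:R : F) != 0.
Hypothesis p_gt1 : (1 < p)%N.
Implicit Types (u v w : F) (n k i j : nat).

(** The coefficient of T ^ n in exp (u (T + T ^ p / p)) *)
Definition dwork_exp u n : F := \sum_(j < n.+1 | (p * j <= n)%N)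
  u ^+ (n - p * j + j) / ((n - p * j)`!%:R * j`!%:R * p%:R ^+ j).

Lemma fact_neq0 n : (n`!%:R : F) != 0.
Proof. by rewrite -(prednK (fact_gt0 n)). Qed.

Lemma p_neq0 : (p%:R : F) != 0.
Proof. by rewrite -(prednK (ltnW p_gt1)). Qed.

Lemma dwork_exp_widen B u n : (forall j, (p * j <= n)%N -> (j < B)%N) ->
  dwork_exp u n = \sum_(j < B | (p * j <= n)%N)
    u ^+ (n - p * j + j) / ((n - p * j)`!%:R * j`!%:R * p%:R ^+ j).
Proof.
move=> nB; rewrite /dwork_exp.
pose G j := u ^+ (n - p * j + j) / ((n - p * j)`!%:R * j`!%:R * p%:R ^+ j).
pose C := (B + n.+1)%N.
have le_n j : (p * j <= n)%N -> (j < n.+1)%N.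
  by move=> h; rewrite ltnS (leq_trans _ h) // leq_pmull // ltnW.
rewrite (big_ord_widen_cond C (fun j => p * j <= n)%N G) ?leq_addl //.
rewrite (big_ord_widen_cond C (fun j => p * j <= n)%N G) ?leq_addr //.
apply: eq_bigl => j; case: (leqP (p * j) n) => // h.
by rewrite (nB _ h) (le_n _ h).
Qed.

Lemma dwork_exp0 u : dwork_exp u 0 = 1.
Proof.
by rewrite /dwork_exp big_mkcond big_ord1 muln0 fact0 expr0 !mulr1 divr1.
Qed.

(** The differential equation f' = w (1 + T ^ (p - 1)) f says that n + 1 times
    the coefficient of T ^ (n + 1) is w * back n a. *)
Definition back n (a : nat -> F) : F :=
  a n + (if (p <= n.+1)%N then a (n.+1 - p)%N else 0).

Lemma dwork_exp_rec u n : n.+1%:R * dwork_exp u n.+1 = u * back n (dwork_exp u).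
Proof.
have p0 := p_neq0; have p_gt0 := ltnW p_gt1.
rewrite /back mulrDr (@dwork_exp_widen n.+2 u n.+1); last first.
  by move=> j h; rewrite ltnS (leq_trans _ h) // leq_pmull.
rewrite mulr_sumr.
rewrite (eq_bigr (fun j : 'I_n.+2 =>
   (n.+1 - p * j)%:R * (u ^+ (n.+1 - p * j + j) /
      ((n.+1 - p * j)`!%:R * j`!%:R * p%:R ^+ j)) +
   (p * j)%:R * (u ^+ (n.+1 - p * j + j) /
      ((n.+1 - p * j)`!%:R * j`!%:R * p%:R ^+ j)))); last first.
  by move=> j h; rewrite -mulrDl -natrD subnK.
rewrite big_split /=; congr (_ + _).
  rewrite (@dwork_exp_widen n.+2 u n); last first.
    by move=> j h; rewrite ltnW // ltnS ltnS (leq_trans _ h) // leq_pmull.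
  rewrite mulr_sumr big_mkcond [RHS]big_mkcond; apply: eq_bigr => j _ /=.
  case: (ltngtP (p * j) n.+1) => h.
  - rewrite ltnS in h; rewrite h subSn // factS natrM addSn exprS.
    have f1 := fact_neq0 (n - p * j); have f2 := fact_neq0 j.
    have f3 := char0 (n - p * j).
    have f4 : (p%:R ^+ j : F) != 0 by rewrite expf_neq0.
    move: f1 f2 f3 f4; move: (u ^+ _) ((n - p * j)`!%:R : F) (j`!%:R : F).
    move: ((n - p * j).+1%:R : F) (p%:R ^+ j : F) => x1 x2 x3 x4 x5 f1 f2 f3 f4.
    by field; rewrite f1 f2 f3 f4.
  - by rewrite ifN // -ltnNge ltnW.
  - by rewrite h subnn mul0r ifN // -ltnNge.
rewrite big_mkcond big_ord_recl /= muln0 mul0r leq0n add0r.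
case: (leqP p n.+1) => pn; last first.
  rewrite mulr0 big1 // => j _; rewrite ifN // /bump add1n -ltnNge.
  by rewrite (leq_trans pn) // leq_pmulr.
rewrite (@dwork_exp_widen n.+1 u (n.+1 - p)); last first.
  move=> j h; rewrite ltnS; apply: leq_trans (_ : p * j <= n)%N.
    by rewrite leq_pmull.
  by apply: leq_trans h _; lia.
rewrite mulr_sumr [RHS]big_mkcond; apply: eq_bigr => j _.
rewrite /bump add1n mulnS leq_subRL //.
case: ifP => // h; rewrite subnDA -mulnS factS !natrM addnS !exprS.
have f1 := fact_neq0 (n.+1 - p - p * j); have f2 := fact_neq0 j.
have f3 := char0 j; have f4 : (p%:R ^+ j : F) != 0 by rewrite expf_neq0.
move: p0 f1 f2 f3 f4; move: (u ^+ _) ((n.+1 - p - p * j)`!%:R : F) (j`!%:R : F).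
move: (j.+1%:R : F) (p%:R ^+ j : F) (p%:R : F) => x1 x2 x3 x4 x5 x6 f0 f1 f2 f3 f4.
by field; rewrite f0 f1 f2 f3 f4.
Qed.

Lemma back_uniq w (a b : nat -> F) : a 0%N = b 0%N ->
  (forall n, n.+1%:R * a n.+1 = w * back n a) ->
  (forall n, n.+1%:R * b n.+1 = w * back n b) -> a =1 b.
Proof.
move=> ab0 aR bR; elim/ltn_ind => -[//|n] IHn.
apply: (mulfI (char0 n)); rewrite aR bR /back IHn //; case: ifP => // pn.
by rewrite IHn // ltn_subrL /= ltnW.
Qed.

Definition conv (a b : nat -> F) n := \sum_(i < n.+1) a i * b (n - i)%N.

Lemma convC a b : conv a b =1 conv b a.
Proof.
move=> n; rewrite /conv (reindex_inj rev_ord_inj) /=.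
by apply: eq_bigr => i _; rewrite subSS mulrC subKn // -ltnS.
Qed.

(** The sum weighted by i is the part of the derivative of a product in which
    the first factor is differentiated. *)
Lemma conv_back u (a b : nat -> F) :
  (forall n, n.+1%:R * a n.+1 = u * back n a) ->
  forall n, \sum_(i < n.+2) i%:R * (a i * b (n.+1 - i)%N) = u * back n (conv a b).
Proof.
move=> aR n; rewrite big_ord_recl mul0r add0r /=.
under eq_bigr => i _ do rewrite /bump add1n subSS mulrA aR -mulrA.
rewrite -mulr_sumr; congr (_ * _); rewrite /back.
under eq_bigr => i _ do rewrite mulrDl.
rewrite big_split /=; congr (_ + _).
case: (leqP p n.+1) => pn; last first.
  by rewrite big1 // => i _; rewrite ifN ?mul0r // -ltnNge; have := ltn_ord i; lia.
have nE : (n.+1 = p.-1 + (n.+1 - p).+1)%N by lia.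
rewrite -(big_mkord xpredT (fun i => (if (p <= i.+1)%N then a (i.+1 - p)%N else 0)
   * b (n - i)%N)) (@big_cat_nat _ _ _ p.-1) //=; last by lia.
rewrite [X in X + _]big_nat_cond [X in X + _]big1 ?add0r => [|i /andP[/andP[_ ip] _]].
  rewrite -{1}[p.-1]add0n big_addn.
  have -> : (n.+1 - p.-1 = (n.+1 - p).+1)%N by lia.
  rewrite big_mkord; apply: eq_bigr => i _.
  rewrite ifT; last by lia.
  by congr (a _ * b _); lia.
by rewrite ifN ?mul0r //; lia.
Qed.

(** Both generating series solve f' = (u + v) (1 + T ^ (p - 1)) f. *)
Lemma dwork_expD u v n : dwork_exp (u + v) n = conv (dwork_exp u) (dwork_exp v) n.
Proof.
apply: (@back_uniq (u + v)); last 1 first.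
- move=> m; rewrite mulrDl.
  rewrite -(conv_back (dwork_exp v) (dwork_exp_rec u)).
  have -> : back m (conv (dwork_exp u) (dwork_exp v)) =
            back m (conv (dwork_exp v) (dwork_exp u)).
    by rewrite /back !(convC (dwork_exp u)).
  rewrite -(conv_back (dwork_exp u) (dwork_exp_rec v)).
  rewrite [X in _ = _ + X](reindex_inj rev_ord_inj) /= -big_split /=.
  rewrite mulr_sumr; apply: eq_bigr => i _.
  rewrite subSS subKn; last by rewrite -ltnS.
  rewrite [dwork_exp v _ * _]mulrC -mulrDl -natrD subnKC // -ltnS //.
- by rewrite /conv big_ord1 subn0 !dwork_exp0 mulr1.
- exact: dwork_exp_rec.
Qed.

(** Here w ^ p = w, so that the series for w is the series for 1 at w T. *)
Lemma dwork_exp_root w n : w ^+ p.-1 = 1 ->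
  dwork_exp w n = w ^+ n * dwork_exp 1 n.
Proof.
move=> w1; rewrite /dwork_exp mulr_sumr; apply: eq_bigr => j pj.
rewrite expr1n div1r; congr (_ * _).
have nE : (n - p * j + j + p.-1 * j = n)%N.
  by rewrite -addnA -mulSn prednK ?subnK // ltnW.
by rewrite -[in RHS]nE [in RHS]exprD exprM w1 expr1n mulr1.
Qed.

(** With c < p, the coefficients in degrees congruent to c are finite
    differences of the sequence phi, once T ^ (p - 1) is replaced by - p. *)
Lemma dwork_exp_fdiff c u (phi : nat -> F) k : (c < p)%N ->
  (forall i, phi i * (p * i + c)`!%:R = (- p%:R) ^+ i * i`!%:R) ->
  (- p%:R) ^+ k * dwork_exp u (p.-1 * k + c) =
  \sum_(i < k.+1) (-1) ^+ (k - i) * 'C(k, i)%:R *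
    ('C(p * i + c, k)%:R * (phi i * u ^+ (p.-1 * i + c))).
Proof.
move=> cp phiE; have p_gt0 := ltnW p_gt1.
have pk : (p * k = p.-1 * k + k)%N by rewrite -mulSnr prednK.
rewrite (@dwork_exp_widen k.+1); last first.
  move=> j; rewrite ltnS; case: (leqP j k) => // kj.
  have : (p * k.+1 <= p * j)%N by rewrite leq_mul2l kj orbT.
  by rewrite mulnS; lia.
rewrite big_mkcond (reindex_inj rev_ord_inj) /= mulr_sumr.
apply: eq_bigr => i _; rewrite subSS.
have ik : (i <= k)%N by rewrite -ltnS.
have pik : (p * (k - i) = p * k - p * i)%N by rewrite mulnBr.
have pi : (p * i = p.-1 * i + i)%N by rewrite -mulSnr prednK.
have lepi : (p.-1 * i <= p.-1 * k)%N by rewrite leq_mul2l ik orbT.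
have -> : (p * (k - i) <= p.-1 * k + c)%N = (k <= p * i + c)%N by lia.
case: leqP => kpi; last by rewrite [X in X%:R * (_ * _)]bin_small // !(mul0r, mulr0).
have -> : (p.-1 * k + c - p * (k - i) = p * i + c - k)%N by lia.
have -> : (p * i + c - k + (k - i) = p.-1 * i + c)%N by lia.
have f1 := fact_neq0 (p * i + c - k); have f2 := fact_neq0 (k - i).
have f3 := fact_neq0 i; have f4 := fact_neq0 k.
have f5 := fact_neq0 (p * i + c).
have e1 : 'C(k, i)%:R = k`!%:R / (i`!%:R * (k - i)`!%:R) :> F.
  by rewrite -(bin_fact ik) !natrM mulfK ?mulf_neq0.
have e2 : 'C(p * i + c, k)%:R =
    (p * i + c)`!%:R / (k`!%:R * (p * i + c - k)`!%:R) :> F.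
  by rewrite -(bin_fact kpi) !natrM mulfK ?mulf_neq0.
have e3 : phi i = (- p%:R) ^+ i * i`!%:R / (p * i + c)`!%:R.
  by apply: (mulIf f5); rewrite divfK.
have e4 : (- p%:R) ^+ k = ((-1) ^+ (k - i) * p%:R ^+ (k - i)) * (- p%:R) ^+ i :> F.
  by rewrite -exprNn -exprD subnK.
rewrite e1 e2 e3 e4.
have f6 : (p%:R ^+ (k - i) : F) != 0 by rewrite expf_neq0 // p_neq0.
move: f1 f2 f3 f4 f5 f6; move: (u ^+ _) (p * i + c - k)`!%:R.
move: (k - i)`!%:R i`!%:R k`!%:R.
move: (p * i + c)`!%:R (p%:R ^+ (k - i)) ((-1) ^+ (k - i)) ((- p%:R) ^+ i).
move=> x1 x2 x3 x4 x5 x6 x7 x8 x9 f1 f2 f3 f4 f5 f6; field.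
by rewrite f1 f2 f3 f4 f5 f6.
Qed.

End DworkExponential.

(** * Convergent series in Z_p *)

Section Series.
Variables (p : nat) (p_pr : prime p).
Local Notation Z := (zpadic p_pr).
Implicit Types (s t : nat -> Z) (S T : Z).

Definition sums_to s S := forall N, exists K0, forall K, (K0 <= K)%N ->
  pdvd N (\sum_(k < K.+1) s k - S).

Lemma sums_to_uniq s S T : sums_to s S -> sums_to s T -> S = T.
Proof.
move=> sS sT; apply: pdvd_eq => N.
have [K0 K0P] := sS N; have [K1 K1P] := sT N.
have := K1P _ (leq_maxr K0 K1); apply: pdvd_trans; rewrite pdvd_subC.
exact: K0P (leq_maxl _ _).
Qed.

Lemma eq_sums_to s t S : s =1 t -> sums_to s S -> sums_to t S.
Proof. by move=> /funext->. Qed.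

Lemma sums_to_comb (I : finType) (P : pred I) (c : I -> Z) (s : I -> nat -> Z)
    (S : I -> Z) : (forall i, P i -> sums_to (s i) (S i)) ->
  sums_to (fun k => \sum_(i | P i) c i * s i k) (\sum_(i | P i) c i * S i).
Proof.
move=> sS N; have [K0 K0P] : exists K0 : I -> nat, forall i, P i -> forall K,
    (K0 i <= K)%N -> pdvd N (\sum_(k < K.+1) s i k - S i).
  have h i : exists k0, P i -> forall K, (k0 <= K)%N ->
      pdvd N (\sum_(k < K.+1) s i k - S i).
    case Pi: (P i); last by exists 0%N.
    by have [k0 k0P] := sS i Pi N; exists k0.
  by have [K0 K0P] := choice h; exists K0.
exists (\max_(i | P i) K0 i) => K KK; rewrite exchange_big /=; apply: pdvdB_sum.
move=> i Pi; rewrite -mulr_sumr -mulrBr pdvdMl // K0P //.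
by apply: leq_trans KK; exact: (leq_bigmax_cond i).
Qed.

Lemma sums_toZ c s S : sums_to s S -> sums_to (fun k => c * s k) (c * S).
Proof.
move=> sS N; have [K0 K0P] := sS N; exists K0 => K KK.
by rewrite -mulr_sumr -mulrBr pdvdMl // K0P.
Qed.

Lemma sums_to_shift s S : sums_to s S ->
  sums_to (fun k => if k is k'.+1 then s k' else 0) S.
Proof.
move=> sS N; have [K0 K0P] := sS N; exists K0.+1 => -[//|K] KK.
by rewrite big_ord_recl add0r; exact: K0P.
Qed.

Lemma sums_to_small s S : sums_to s S ->
  forall N, exists K0, forall k, (K0 <= k)%N -> pdvd N (s k).
Proof.
move=> sS N; have [K0 K0P] := sS N; exists K0.+1 => -[//|k] kK.
have -> : s k.+1 = \sum_(i < k.+2) s i - \sum_(i < k.+1) s i.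
  by rewrite [X in X - _]big_ord_recr /= addrAC subrr add0r.
apply: pdvd_trans (K0P k.+1 (ltnW kK)) _.
by rewrite pdvd_subC K0P.
Qed.

(** In the product with i-th factor t i, either i is large and t i is small, or
    the complementary partial sum of s is close to S. *)
Lemma cauchy_product s t S T : sums_to s S -> sums_to t T ->
  sums_to (fun k => \sum_(i < k.+1) s (k - i)%N * t i) (S * T).
Proof.
move=> sS tT N; have [K0 K0P] := sS N; have [K1 K1P] := tT N.
have [K2 K2P] := sums_to_small tT N.
pose A m := \sum_(i < m.+1) s i.
have E K : \sum_(k < K.+1) \sum_(i < k.+1) s (k - i)%N * t i =
           \sum_(i < K.+1) A (K - i)%N * t i.
  elim: K => [|K IHK]; first by rewrite !big_ord1 /A big_ord1.
  rewrite big_ord_recr /= IHK [X in _ + X = _]big_ord_recr [RHS]big_ord_recr.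
  rewrite /= subnn.
  rewrite addrA -big_split /=; congr (_ + _); last by rewrite /A big_ord1.
  apply: eq_bigr => i _; rewrite -mulrDl subSn; last by rewrite -ltnS.
  by rewrite /A [in RHS]big_ord_recr.
exists (maxn K1 (K0 + K2)) => K; rewrite geq_max => /andP[KK1 KK2]; rewrite E.
have tail : pdvd N (\sum_(i < K.+1) A (K - i)%N * t i -
                    \sum_(i < K.+1) S * t i).
  apply: pdvdB_sum => i _; rewrite -mulrBl; case: (leqP K2 i) => iK.
    by rewrite pdvdMl // K2P.
  by rewrite pdvdMr // K0P //; lia.
apply: (pdvd_trans tail).
by rewrite -mulr_sumr -mulrBr pdvdMl // K1P.
Qed.

End Series.

(** * Jacobi sums as quotients of values of Gamma *)

Section QpadicMorphism.
Variables (p : nat) (p_pr : prime p).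
HB.instance Definition _ := GRing.isZmodMorphism.Build (zpadic p_pr)
  (qpadic p_pr) (@zpadic_to_qpadic p p_pr) (@tofrac_is_zmod_morphism (zpadic p_pr)).
HB.instance Definition _ := GRing.isMonoidMorphism.Build (zpadic p_pr)
  (qpadic p_pr) (@zpadic_to_qpadic p p_pr) (tofrac_is_monoid_morphism (zpadic p_pr)).

Lemma zpadic_to_qpadic_eq0 (x : zpadic p_pr) :
  (zpadic_to_qpadic x == 0) = (x == 0).
Proof. exact: tofrac_eq0. Qed.

Lemma zpadic_to_qpadic_inj : injective (@zpadic_to_qpadic p p_pr).
Proof.
move=> x y /eqP; rewrite -subr_eq0 -rmorphB zpadic_to_qpadic_eq0 subr_eq0.
by move/eqP.
Qed.

Lemma qpadic_char0 n : (n.+1%:R : qpadic p_pr) != 0.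
Proof.
by rewrite -(rmorph_nat (@zpadic_to_qpadic p p_pr)) zpadic_to_qpadic_eq0
  zpadic_natr_eq0.
Qed.

End QpadicMorphism.

Section DworkTerms.
Variables (p : nat) (p_pr : prime p).
Hypothesis p_gt2 : (2 < p)%N.
Local Notation Z := (zpadic p_pr).
Local Notation teich := (teichmuller p_pr).
Local Notation gnat := (pgamma_nat p_pr).
Local Notation grat := (grat p_pr).

(** This is (- p) ^ i i! / (p i + c)! for c < p ([fact_ratioE]); written with
    pgamma_nat, it is visibly continuous in i. *)
Definition fact_ratio c i : Z := (-1) ^+ c.+1 * (gnat (p * i + c).+1)^-1.

Lemma fact_pgamma_nat n :
  n`!%:R = (-1) ^+ n.+1 * gnat n.+1 * p%:R ^+ (n %/ p) * ((n %/ p)`!)%:R.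
Proof.
have p_gt0 := prime_gt0 p_pr.
elim: n => [|n IHn].
  by rewrite div0n pgamma_natS dvdn0 pgamma_nat0 !mulr1 expr1 mulrNN mulr1.
rewrite factS natrM IHn divnS // (pgamma_natS _ n.+1) (exprS _ n.+1).
case: (boolP (p %| n.+1)%N) => pn /=; rewrite ?add0n ?add1n; last by ring.
have e : n.+1%:R = p%:R * (n %/ p).+1%:R :> Z.
  by rewrite -natrM; have := divnK pn; rewrite divnS // pn /= add1n mulnC => ->.
by rewrite e [(_.+1)`!]factS natrM (exprS p%:R); ring.
Qed.

Lemma fact_ratioE c i : (c < p)%N ->
  fact_ratio c i * (p * i + c)`!%:R = (- p%:R) ^+ i * i`!%:R.
Proof.
move=> cp; have p_gt0 := prime_gt0 p_pr; rewrite (fact_pgamma_nat (p * i + c)).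
have -> : ((p * i + c) %/ p = i)%N.
  by rewrite mulnC divnMDl // divn_small // addn0.
rewrite /fact_ratio; have u := pgamma_nat_unit p_pr (p * i + c).+1.
have -> : (-1) ^+ (p * i + c).+1 = (-1) ^+ i * (-1) ^+ c.+1 :> Z.
  rewrite -exprD -signr_odd -[RHS]signr_odd -addnS !oddD oddM.
  by rewrite (p_odd p_pr p_gt2).
rewrite (exprNn p%:R); set g := gnat _ in u *; set s := (-1) ^+ c.+1.
have ss : s * s = 1 by rewrite /s -exprD addnn -muln2 mulnC exprM sqrrN !expr1n.
transitivity (s * s * (g^-1 * g) * ((-1) ^+ i * p%:R ^+ i * i`!%:R)).
  by move: g^-1 => g'; ring.
by rewrite ss mulVr // !mul1r.
Qed.

Definition dterm c (u : Z) k : Z :=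
  trterm c (fun i => fact_ratio c i * u ^+ (p.-1 * i + c)) k.

Lemma dterm_dwork_exp (F : fieldType) (io : {rmorphism Z -> F}) c u k :
  (forall n, (n.+1%:R : F) != 0) -> (c < p)%N ->
  io (dterm c u k) = (- p%:R) ^+ k * dwork_exp p (io u) (p.-1 * k + c).
Proof.
move=> char0 cp.
rewrite (@dwork_exp_fdiff _ _ char0 (prime_gt1 p_pr) c _
          (fun i => io (fact_ratio c i))) // => [|i]; last first.
  by rewrite -(rmorph_nat io) -rmorphM fact_ratioE // rmorphM rmorphXn rmorphN
    !rmorph_nat.
rewrite /dterm trtermE rmorph_sum; apply: eq_bigr => i _.
move: (fact_ratio c i) => phi.
by rewrite !rmorphM /= !rmorphXn /= !rmorph_nat rmorphN rmorph1.
Qed.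

Lemma grat_inv c : (c < p)%N -> grat c = (-1) ^+ c.+1 * (grat (p.-1 - c))^-1.
Proof.
move=> cp; apply: (mulIr (grat_unit p_pr p_gt2 (p.-1 - c))).
by rewrite divrK ?grat_unit // grat_reflection // exprS mulN1r.
Qed.

Lemma one_sub_p_unit : (1 - p%:R : Z) \is a GRing.unit.
Proof.
rewrite -opprB unitrN -(@natrB _ p 1) ?prime_gt0 // subn1.
exact: pred_unit.
Qed.

(** The coefficients of degree congruent to c in exp (u (T + T ^ p / p)), with
    T ^ (p - 1) replaced by - p, are summed by the trace formula. At the fixed
    point i = - c / (p - 1) one has p i + c + 1 = 1 - c / (p - 1), and the
    exponent (p - 1) i + c tends to 0 while staying congruent to c modulo p - 1,
    so that the power of u tends to a power of its Teichmuller representative. *)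
Lemma dterm_sum c u : (c < p)%N -> u \is a GRing.unit ->
  sums_to (dterm c u) (teich (residue u) ^+ c * grat c / (1 - p%:R)).
Proof.
move=> cp uu N; have p_gt0 := prime_gt0 p_pr.
have ru0 : residue u != 0 by rewrite residue_eq0 -zpadic_unitE.
set w := teich (residue u).
have uw : pdvd 1 (u - w) by rewrite -residue_eq residue_teich.
have u1 : pdvd 1 (u ^+ p.-1 - 1) by apply: pdvd_Fermat; rewrite -zpadic_unitE.
pose f i := fact_ratio c i * u ^+ (p.-1 * i + c).
have fC M : exists M', forall m, pdvd M (f (m + p ^ M')%N - f m).
  exists M => m; apply: pdvdBM.
    rewrite -mulrBr pdvdMl //; apply: pdvdB_inv; rewrite ?pgamma_nat_unit //.
    have -> : ((p * (m + p ^ M) + c).+1 = (p * m + c).+1 + p ^ M.+1)%N.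
      by rewrite mulnDr expnS; lia.
    by apply: (@pdvdW _ _ _ M.+1) => //; apply: pgamma_natDexpp.
  rewrite mulnDr addnAC exprD -[X in _ - X]mulr1 -mulrBr pdvdMl //.
  rewrite exprM; apply: (@pdvdW _ _ _ M.+1) => //.
  by have := pdvdB_exppX M u1; rewrite expr1n.
have fl M : exists M', forall s, (p ^ M' %| p.-1 * s + c)%N ->
    pdvd M (f s - w ^+ c * grat c).
  exists M => s sc; rewrite mulrC; apply: pdvdBM; last first.
    have -> : w ^+ c = w ^+ (p.-1 * s + c).
      by rewrite exprD exprM teich_exp // expr1n mul1r.
    have /dvdnP[d ->] := sc; rewrite mulnC !exprM; apply: pdvdBX.
    by apply: (@pdvdW _ _ _ M.+1) => //; exact: pdvdB_exppX.
  rewrite grat_inv // -mulrBr pdvdMl //.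
  apply: pdvdB_inv; rewrite ?pgamma_nat_unit ?grat_unit // pdvd_subC.
  apply: pgamma_approx => //.
  have -> : ((p.-1 - c)%:R / p.-1%:R : Z) = 1 - c%:R / p.-1%:R.
    rewrite natrB ?mulrBl ?divrr ?pred_unit //; lia.
  have -> : (p * s + c).+1 = (1 + s + (p.-1 * s + c))%N.
    by rewrite -{1}(prednK p_gt0) mulSn; lia.
  have -> : 1 - c%:R / p.-1%:R - (1 + s + (p.-1 * s + c))%N%:R =
     - (s%:R + c%:R / p.-1%:R) - (p.-1 * s + c)%N%:R :> Z.
    by rewrite [X in _ - X = _]natrD [X in _ - (X + _) = _]natrD; ring.
  apply: pdvdB; last by rewrite pdvd_nat.
  by rewrite pdvdN; apply: pdvd_natr_pred.
have [K0 K0P] := trace_formula p_gt2 fC fl N.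
exists K0 => K KK; rewrite -(pdvd_unit_cancel _ _ one_sub_p_unit).
rewrite mulrBr mulrC [X in _ - X]mulrC divrK ?one_sub_p_unit // mulrC.
exact: K0P.
Qed.

Lemma dterm_sum0 c : (0 < c)%N -> sums_to (dterm c 0) 0.
Proof.
move=> c0 N; exists 0%N => K _; rewrite subr0; apply: pdvd_sum => k _.
rewrite /dterm trtermE; apply: pdvd_sum => i _.
by rewrite expr0n addn_eq0 (gtn_eqF c0) andbF !mulr0 pdvd0.
Qed.

End DworkTerms.

Lemma sum_residue_class (V : nmodType) (q b K : nat) (P : pred nat) (G : nat -> V) :
  (b < q)%N ->
  \sum_(j < q * K | (q %| q - b + j)%N && P j) G j =
  \sum_(i < K | P (q * i + b)%N) G (q * i + b)%N.
Proof.
move=> bq; elim: K => [|K IHK].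
  rewrite [in RHS]big_mkcond big_ord0 big_mkcond.
  by rewrite big1 // => -[i i0]; exfalso; rewrite muln0 in i0.
rewrite [LHS]big_mkcond [RHS]big_mkcond /= in IHK.
rewrite [LHS]big_mkcond [RHS]big_mkcond /=.
rewrite [RHS]big_ord_recr /= -IHK {IHK}.
have -> : (q * K.+1 = q * K + q)%N by rewrite mulnSr.
have dv d : (d < q)%N -> (q %| q - b + (q * K + d))%N = (d == b).
  move=> dq; rewrite addnCA dvdn_addr ?dvdn_mulr //.
  apply/idP/eqP => [/dvdnP[e]|->]; last by rewrite subnK // ltnW.
  by case: e => [|[|e]]; rewrite ?mulSn; lia.
rewrite big_split_ord /=; congr (_ + _).
rewrite (bigD1 (Ordinal bq)) //= dv // eqxx big1 ?addr0 // => d db.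
have db' : (d != b :> nat) := db.
by rewrite dv // (negPf db').
Qed.

Section JacobiSums.
Variables (p : nat) (p_pr : prime p).
Hypothesis p_gt2 : (2 < p)%N.
Local Notation Z := (zpadic p_pr).
Local Notation teich := (teichmuller p_pr).
Local Notation grat := (@grat p p_pr).

Local Notation chi := (teich_char p_pr).

Let q := p.-1.

Section Convolutions.
Variables (F : fieldType) (io : {rmorphism Z -> F}).
Hypothesis char0 : forall n, (n.+1%:R : F) != 0.
Hypothesis io_inj : injective io.

(** Expand the series for w + 1 as a product of the series for w and for 1; the
    average over the roots of unity w keeps the exponents of the first factor
    that are congruent to b. *)
Lemma dwork_exp_class b c k : (b < q)%N -> (c < q)%N ->
  \sum_(x : 'F_p | x != 0)
     io (teich x ^+ (q - b) * dterm c (teich x + 1) k) =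
  q%:R * (- p%:R) ^+ k *
  \sum_(i < k.+1 | (q * i + b <= q * k + c)%N)
    dwork_exp p 1 (q * i + b) * dwork_exp p 1 (q * k + c - (q * i + b)).
Proof.
move=> bq cq; have p_gt0 := prime_gt0 p_pr.
have cp : (c < p)%N by apply: (leq_trans cq); rewrite leq_pred.
set n := (q * k + c)%N.
pose e := @dwork_exp F p 1.
transitivity ((- p%:R) ^+ k * \sum_(j < n.+1)
   \sum_(x : 'F_p | x != 0) io (teich x ^+ (q - b + j)) * (e j * e (n - j)%N)).
  rewrite exchange_big /= mulr_sumr; apply: eq_bigr => x x0.
  rewrite rmorphM dterm_dwork_exp // rmorphD rmorph1.
  rewrite (dwork_expD char0 (prime_gt1 p_pr)) /conv mulrCA; congr (_ * _).
  rewrite mulr_sumr; apply: eq_bigr => j _.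
  rewrite (dwork_exp_root (prime_gt1 p_pr)); last first.
    by rewrite -rmorphXn teich_exp // rmorph1.
  by rewrite exprD rmorphM !rmorphXn /= !mulrA.
rewrite [q%:R * _]mulrC -mulrA; congr (_ * _).
transitivity (\sum_(j < n.+1 | (q %| q - b + j)%N) q%:R * (e j * e (n - j)%N)).
  rewrite [RHS]big_mkcond; apply: eq_bigr => j _.
  rewrite -mulr_suml -rmorph_sum sum_teich -/q.
  by case: ifP => _; rewrite ?rmorph0 ?mul0r // rmorph_nat.
rewrite -mulr_sumr; congr (_ * _).
have nk : (n.+1 <= q * k.+1)%N by rewrite mulnSr ltn_add2l.
rewrite (big_ord_widen_cond _ (fun j => q %| q - b + j)%N
  (fun j => e j * e (n - j)%N) nk).
exact: (sum_residue_class k.+1 (fun j => j < n.+1)%N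
         (fun j => e j * e (n - j)%N) bq).
Qed.

Lemma dterm_convolution b c k : (b <= c)%N -> (c < q)%N ->
  \sum_(x : 'F_p | x != 0) teich x ^+ (q - b) * dterm c (teich x + 1) k =
  q%:R * \sum_(i < k.+1) dterm (c - b) 1 (k - i)%N * dterm b 1 i.
Proof.
move=> bc cq; have bq := leq_ltn_trans bc cq.
apply: io_inj; rewrite rmorph_sum dwork_exp_class //.
rewrite rmorphM rmorph_nat -mulrA; congr (_ * _).
rewrite rmorph_sum mulr_sumr big_mkcond; apply: eq_bigr => i _.
have ik : (i <= k)%N by rewrite -ltnS.
have qik : (q * i <= q * k)%N by rewrite leq_mul2l ik orbT.
rewrite ifT; last by lia.
rewrite rmorphM !dterm_dwork_exp //; first last.
- by have := leq_pred p; rewrite -/q; lia.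
- by have := leq_pred p; rewrite -/q; lia.
rewrite rmorph1 -/q.
have -> : (q * k + c - (q * i + b) = q * (k - i) + (c - b))%N.
  by rewrite mulnBr; lia.
by rewrite -{1}(subnK ik) exprD; ring.
Qed.

Lemma dterm_convolution_carry b c k : (c < b)%N -> (b < q)%N ->
  \sum_(x : 'F_p | x != 0) teich x ^+ (q - b) * dterm c (teich x + 1) k =
  (- p%:R * q%:R) * (if k is k'.+1 then
     \sum_(i < k'.+1) dterm (c + q - b) 1 (k' - i)%N * dterm b 1 i else 0).
Proof.
move=> cb bq; have cq := ltn_trans cb bq.
apply: io_inj; rewrite rmorph_sum dwork_exp_class //.
case: k => [|k].
  rewrite big_mkcond big_ord1 ifN ?mulr0 ?rmorph0 //.
  by rewrite muln0 !add0n -ltnNge.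
rewrite big_mkcond big_ord_recr /= [X in _ + X]ifN; last first.
  by rewrite -ltnNge ltn_add2l.
rewrite addr0 rmorphM rmorph_sum !mulr_sumr; apply: eq_bigr => i _.
have ik : (i <= k)%N by rewrite -ltnS.
have qik : (q * i <= q * k)%N by rewrite leq_mul2l ik orbT.
rewrite ifT; last by rewrite mulnSr; lia.
rewrite !rmorphM rmorphN !rmorph_nat !dterm_dwork_exp //; first last.
- by have := leq_pred p; rewrite -/q; lia.
- by have := leq_pred p; rewrite -/q; lia.
rewrite rmorph1 -/q.
have -> : (q * k.+1 + c - (q * i + b) = q * (k - i) + (c + q - b))%N.
  by rewrite mulnBr mulnSr; lia.
by rewrite exprS -{1}(subnK ik) exprD; ring.
Qed.

End Convolutions.

(** The Gross-Koblitz formula for Jacobi sums. Both sides are the sum over k of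
    the convolution identities above, computed by [dterm_sum] for u = w + 1 on
    the one hand and for u = 1 on the other. When c < b, the exponents b and c - b
    add up to c only after a carry of p - 1, which brings a factor - p. *)
Lemma jacobi_pgamma b c : (b < q)%N -> (0 < c < q)%N ->
  grat c * \sum_(x : 'F_p) chi (q - b) x * chi c (1 + x) =
  - ((if (c < b)%N then - p%:R else 1) * grat b *
     grat (if (c < b)%N then c + q - b else c - b)%N).
Proof.
move=> bq /andP[c0 cq].
have qp : (q < p)%N by rewrite /q prednK ?prime_gt0.
have cp := ltn_trans cq qp; have bp := ltn_trans bq qp.
have sc (x : 'F_p) : x != 0 -> sums_to (dterm c (teich x + 1))
    (chi c (1 + x) * grat c / (1 - p%:R)).
  move=> x0; have e : residue (teich x + 1) = 1 + x.
    by rewrite residueD residue_teich // residue1 addrC.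
  case: (eqVneq (1 + x) 0) => x1.
    have -> : teich x = -1.
      rewrite -(teichN1 p_pr p_gt2); congr teich; apply/eqP.
      by rewrite -addr_eq0 addrC x1.
    by rewrite addNr x1 /teich_char eqxx !mul0r; apply: dterm_sum0.
  rewrite teich_charE // -e; apply: dterm_sum => //.
  by rewrite zpadic_unitE -residue_eq0 e.
have s1 a : (a < p)%N -> sums_to (dterm a 1) (grat a / (1 - p%:R)).
  move=> ap; have := dterm_sum p_gt2 ap (unitr1 Z).
  by rewrite residue1 teich1 expr1n mul1r.
have L := sums_to_comb (fun x : 'F_p => teich x ^+ (q - b)) sc.
have u := one_sub_p_unit p_pr p_gt2.
have qc := qpadic_char0 p_pr; have qi := @zpadic_to_qpadic_inj p p_pr.
have qE : q%:R = - (1 - p%:R) :> Z.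
  by rewrite opprB -(@natrB _ p 1) ?prime_gt0 // subn1.
set v := (1 - p%:R)^-1 in L sc s1.
set d := if (c < b)%N then (c + q - b)%N else (c - b)%N.
have R : sums_to (fun k => \sum_(x : 'F_p | x != 0)
     teich x ^+ (q - b) * dterm c (teich x + 1) k)
   ((if (c < b)%N then - p%:R else 1) * q%:R * ((grat d * v) * (grat b * v))).
  have dp : (d < p)%N by rewrite /d; case: ifP; lia.
  have P := cauchy_product (s1 d dp) (s1 b bp).
  rewrite /d in P *; case: ltnP P => cb P.
    apply: eq_sums_to (sums_toZ (- p%:R * q%:R) (sums_to_shift P)) => k.
    by rewrite (dterm_convolution_carry qc qi).
  apply: eq_sums_to (sums_toZ (1 * q%:R) P) => k.
  by rewrite (dterm_convolution qc qi) // mul1r.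
have := sums_to_uniq L R; rewrite qE -/d.
have -> : \sum_(i : 'F_p | i != 0) teich i ^+ (q - b) * (chi c (1 + i) * grat c * v)
  = grat c * (\sum_(x : 'F_p) chi (q - b) x * chi c (1 + x)) * v.
  rewrite mulr_sumr mulr_suml big_mkcond; apply: eq_bigr => x _ /=.
  case: eqVneq => [->|x0]; first by rewrite /teich_char eqxx mul0r mulr0 mul0r.
  by rewrite (teich_charE p_pr (q - b) x0); ring.
move=> h; apply: (mulIr (_ : v \is a GRing.unit)); first by rewrite unitrV.
rewrite h; set s := if _ then _ else _.
have uv : (1 - p%:R) * v = 1 := mulrV u.
rewrite -[RHS]mul1r -[X in _ = X * _]uv; move: (v) (1 - p%:R) => v' w; ring.
Qed.

End JacobiSums.

(** * The cubic character sum and its Fourier coefficients *)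

Section CharacterSums.
Variables (p : nat) (p_pr : prime p).
Hypothesis p_gt3 : (3 < p)%N.
Local Notation Z := (zpadic p_pr).
Local Notation teich := (teichmuller p_pr).
Local Notation chi := (teich_char p_pr).
Implicit Types (x y s t : 'F_p).

Let p_gt2 : (2 < p)%N. Proof. exact: ltnW. Qed.
Let q := p.-1.
Let h := q./2.

Lemma q_double : q = (h * 2)%N.
Proof.
rewrite /h muln2 even_halfK // /q -subn1 oddB ?prime_gt0 //.
by rewrite (p_odd p_pr p_gt2).
Qed.

Lemma chiM k x y : chi k (x * y) = chi k x * chi k y.
Proof.
rewrite /teich_char mulf_eq0; case: eqVneq => [_|x0] /=; first by rewrite mul0r.
case: eqVneq => [_|y0] /=; first by rewrite mulr0.
by rewrite teichM // exprMn.
Qed.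

Lemma chiD k l x : chi (k + l) x = chi k x * chi l x.
Proof. by rewrite /teich_char; case: eqVneq => _; rewrite ?mul0r // exprD. Qed.

Lemma chi1 k : chi k 1 = 1.
Proof. by rewrite /teich_char oner_eq0 teich1 expr1n. Qed.

Lemma eq_chi k l x : (k = l %[mod q])%N -> chi k x = chi l x.
Proof.
by move=> kl; rewrite /teich_char; case: eqVneq => // x0; apply: teich_expM.
Qed.

Lemma chi_unit k x : x != 0 -> chi k x \is a GRing.unit.
Proof. by move=> x0; rewrite teich_charE // unitrX // teich_unit. Qed.

Lemma chiN1 k : chi k (-1) = (-1) ^+ k.
Proof. by rewrite teich_charE ?oppr_eq0 ?oner_eq0 // teichN1. Qed.

Lemma chi_opp k x : chi k (- x) = (-1) ^+ k * chi k x.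
Proof. by rewrite -[- x]mulN1r chiM chiN1. Qed.

Lemma chi_inv k l x : x != 0 -> (k + l = 0 %[mod q])%N -> chi k x^-1 = chi l x.
Proof.
move=> x0 kl; apply: (mulIr (chi_unit k x0)).
rewrite -chiM mulVf // chi1 -chiD addnC (eq_chi _ kl).
by rewrite teich_charE // expr0.
Qed.

Lemma chi_sqr k x : chi k (x ^+ 2) = chi (k * 2) x.
Proof. by rewrite expr2 chiM -chiD muln2 addnn. Qed.

Lemma sum_chi k : \sum_(x : 'F_p) chi k x = if (q %| k)%N then q%:R else 0.
Proof.
transitivity (\sum_(x : 'F_p | x != 0) teich x ^+ k); last exact: sum_teich.
rewrite [RHS]big_mkcond; apply: eq_bigr => x _ /=.
by rewrite /teich_char; case: eqVneq.
Qed.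

(** Up to sign, the trace of Frobenius of y ^ 2 = x ^ 3 - 3 x + 2 - 4 t, where
    the sum is computed in Z_p *)
Definition cubic_sum t : Z := \sum_x chi h (x ^+ 3 - 3%:R * x + 2%:R - 4%:R * t).

Lemma cubic_sum_refl t : cubic_sum (1 - t) = (-1) ^+ h * cubic_sum t.
Proof.
rewrite /cubic_sum (reindex_inj (@oppr_inj _)) mulr_sumr; apply: eq_bigr => x _.
by rewrite -chi_opp; congr (chi h _); ring.
Qed.

Definition cubic_coef m : Z := \sum_s chi (q - m) s * cubic_sum s.

Lemma cubic_inversion t : t != 0 ->
  \sum_(m < q) chi m t * cubic_coef m = q%:R * cubic_sum t.
Proof.
move=> t0; rewrite /cubic_coef; under eq_bigr => m _ do rewrite mulr_sumr.
rewrite exchange_big (bigD1 t) //= [X in _ + X]big1 ?addr0 => [|s st].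
  rewrite (eq_bigr (fun=> cubic_sum t)) ?sumr_const ?card_ord ?mulr_natl // => m _.
  rewrite mulrA -chiD subnKC; last exact: ltnW (ltn_ord m).
  by rewrite teich_charE // teich_exp // mul1r.
have [->|s0] := eqVneq s 0.
  by rewrite big1 // => m _; rewrite /teich_char eqxx mul0r mulr0.
set w := teich (t / s); have ts0 : t / s != 0 by rewrite mulf_neq0 ?invr_eq0.
rewrite (eq_bigr (fun m : 'I_q => w ^+ m * cubic_sum s)) => [|m _]; last first.
  rewrite mulrA -(@chi_inv m (q - m) s) ?subnKC ?modnn ?mod0n //
    ?(ltnW (ltn_ord m)) //.
  by rewrite -chiM teich_charE.
rewrite -mulr_suml; have w1 : w != 1.
  apply: contraNneq st => w1.
  rewrite -[s]mul1r -[1](residue1 p_pr) -w1 residue_teich //.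
  by rewrite divfK.
have := subrX1 w q; rewrite /w teich_exp // subrr -/w => /esym/eqP.
by rewrite mulf_eq0 subr_eq0 (negPf w1) /= => /eqP->; rewrite mul0r.
Qed.

Definition jac1 m : Z := \sum_y chi (q - m) y * chi h (1 + y).
Definition jac2 m : Z :=
  \sum_y chi ((q - m) * 2) y * chi (h + (q - m)) (1 + y).

Lemma natF_neq0 n : (0 < n < p)%N -> (n%:R : 'F_p) != 0.
Proof.
by case/andP=> n0 np; rewrite -(dvdn_pcharf (pchar_Fp p_pr)) gtnNdvd.
Qed.

Lemma four_neq0 : (4%:R : 'F_p) != 0.
Proof. by rewrite (natrM _ 2 2) mulf_neq0 // natF_neq0. Qed.

Lemma chi_h4 : chi h 4%:R = 1.
Proof.
rewrite (natrM _ 2 2) -expr2 chi_sqr -q_double teich_charE ?teich_exp //.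
all: by rewrite natF_neq0.
Qed.

(** For f != 0, the substitution s = - (f / 4) y gives a multiple of [jac1]. *)
Lemma cubic_fiber m f : (m < q)%N ->
  \sum_s chi (q - m) s * chi h (f - 4%:R * s) =
  (-1) ^+ m * chi m 4%:R * jac1 m * chi (h + (q - m)) f +
  (if f == 0 then (if m == h then (-1) ^+ h * q%:R else 0) else 0).
Proof.
move=> mq; have h_gt0 : (0 < h)%N by move: q_double; rewrite /q; lia.
case: eqVneq => [->|f0].
  rewrite [chi _ 0]/teich_char eqxx mulr0 add0r.
  rewrite (eq_bigr (fun s => (-1) ^+ h * chi (q - m + h) s)) => [|s _]; last first.
    by rewrite sub0r chi_opp chiM chi_h4 mul1r chiD; ring.
  rewrite -mulr_sumr sum_chi.
  have -> : (q %| q - m + h)%N = (m == h).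
    apply/idP/eqP => [/dvdnP[e]|->]; last by rewrite subnK // q_double; lia.
    by have := q_double; case: e => [|[|e]]; rewrite ?mulSn; lia.
  by case: ifP => _; rewrite ?mulr0.
rewrite addr0; set g := - (f / 4%:R).
have g0 : g != 0 by rewrite oppr_eq0 mulf_neq0 ?invr_eq0 ?four_neq0.
rewrite (reindex_inj (mulfI g0)) /=.
rewrite (eq_bigr (fun y => chi (q - m) g * chi h f *
   (chi (q - m) y * chi h (1 + y)))) => [|y _]; last first.
  have -> : f - 4%:R * (g * y) = f * (1 + y).
    by rewrite /g mulrA mulrN [4%:R * _]mulrC divfK ?four_neq0 //; ring.
  by rewrite !chiM; ring.
rewrite -mulr_sumr -/(jac1 m) /g chi_opp chiM chiD.
rewrite (@chi_inv (q - m) m) ?four_neq0 ?subnK ?modnn ?mod0n //; last exact: ltnW.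
have -> : (-1) ^+ (q - m) = (-1) ^+ m :> Z.
  rewrite -signr_odd -[RHS]signr_odd oddB ?(ltnW mq) // q_double muln2.
  by rewrite odd_double.
by ring.
Qed.

(** The substitution x = 1 + 3 y turns x ^ 3 - 3 x + 2 into 27 y ^ 2 (1 + y). Its
    two zeros y = 0 and y = -1 give the correction for the quadratic character. *)
Lemma cubic_coefE m : (m < q)%N -> cubic_coef m =
  (-1) ^+ m * chi m 4%:R * chi (h + (q - m)) 27%:R * jac1 m * jac2 m +
  (if m == h then 2%:R * ((-1) ^+ h * q%:R) else 0).
Proof.
move=> mq; rewrite /cubic_coef /cubic_sum.
under eq_bigr => s _ do rewrite mulr_sumr.
rewrite exchange_big /=; under eq_bigr => x _ do rewrite cubic_fiber //.
have three0 : (3%:R : 'F_p) != 0 by rewrite natF_neq0.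
have inj : injective (fun y : 'F_p => 1 + 3%:R * y).
  by move=> x y /addrI/(mulfI three0).
rewrite (reindex_inj inj) big_split /=; congr (_ + _).
  rewrite -mulr_sumr /jac2.
  rewrite (eq_bigr (fun y => chi (h + (q - m)) 27%:R *
    (chi ((q - m) * 2) y * chi (h + (q - m)) (1 + y)))) => [|y _].
    by rewrite -mulr_sumr; ring.
  have -> : (1 + 3%:R * y) ^+ 3 - 3%:R * (1 + 3%:R * y) + 2%:R =
     27%:R * (y ^+ 2 * (1 + y)) by ring.
  rewrite 2!chiM chi_sqr; congr (_ * (_ * _)); apply: eq_chi.
  by rewrite mulnDl -q_double modnDl.
set e := if m == h then _ else _.
transitivity (\sum_(y in [set 0; -1 : 'F_p]) e).
  rewrite [RHS]big_mkcond; apply: eq_bigr => y _.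
  have -> : (1 + 3%:R * y) ^+ 3 - 3%:R * (1 + 3%:R * y) + 2%:R =
     (3%:R ^+ 3) * (y ^+ 2 * (1 + y)) by ring.
  rewrite !mulf_eq0 (negPf three0) /= orbb !inE.
  by rewrite (addrC 1) addr_eq0.
rewrite sumr_const cards2 eq_sym oppr_eq0 oner_eq0 /= /e.
by case: ifP => _; rewrite ?mul0rn // mulr_natl.
Qed.

Lemma jac2_half : jac2 h = p%:R - 2%:R.
Proof.
rewrite /jac2; have qh : (q - h = h)%N by rewrite q_double; lia.
have e y : chi ((q - h) * 2) y * chi (h + (q - h)) (1 + y) =
    (if y \in [set 0; -1 : 'F_p] then 0 else 1).
  rewrite qh addnn -muln2 -q_double /teich_char !inE (addrC 1) addr_eq0.
  case: eqVneq => y0 /=; first by rewrite mul0r.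
  case: eqVneq => y1 /=; first by rewrite mulr0.
  by rewrite !teich_exp ?mulr1 // addr_eq0.
under eq_bigr => y _ do rewrite e.
rewrite (bigID (mem [set 0; -1 : 'F_p])) /= big1 ?add0r => [|y ->//].
rewrite (eq_bigr (fun=> 1)) => [|y /negPf->//].
rewrite sumr_const -[X in X%:R - _](_ : #|'F_p| = p); last by rewrite card_Fp.
rewrite -(cardC (mem [set 0; -1 : 'F_p])) natrD cards2 eq_sym oppr_eq0 oner_eq0 /=.
by rewrite addrAC subrr add0r; congr (_%:R).
Qed.

End CharacterSums.

(** * The coefficients as products of values of Gamma *)

Section Coefficients.
Variables (p : nat) (p_pr : prime p).
Hypothesis p_gt3 : (3 < p)%N.
Local Notation Z := (zpadic p_pr).
Local Notation teich := (teichmuller p_pr).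
Local Notation chi := (teich_char p_pr).
Local Notation grat := (@grat p p_pr).

Let p_gt2 : (2 < p)%N. Proof. exact: ltnW. Qed.
Let q := p.-1.
Let h := q./2.
Let qE : q = (h * 2)%N. Proof. exact: q_double. Qed.

Definition gfrac a d : Z := pgamma (a%:R / d%:R).

Lemma gfrac_unit a d : gfrac a d \is a GRing.unit.
Proof. exact: pgamma_unit. Qed.

Lemma natr_unit_small n : (0 < n < p)%N -> (n%:R : Z) \is a GRing.unit.
Proof. by case/andP=> n0 np; rewrite zpadic_nat_unit gtnNdvd. Qed.

Lemma q_unit : (q%:R : Z) \is a GRing.unit.
Proof. by apply: natr_unit_small; rewrite /q; lia. Qed.

Lemma div_div_add m n j : (m%:R : Z) \is a GRing.unit ->
  (n%:R / q%:R + j%:R) / m%:R = (n + j * q)%:R / (m * q)%:R :> Z.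
Proof.
move=> mu; have qu := q_unit; apply: (mulIr mu); rewrite divrK //.
apply: (mulIr qu); rewrite mulrDl divrK // -[RHS]mulrA -[m%:R * _]natrM divrK.
  by rewrite natrD natrM.
by rewrite natrM unitrM mu.
Qed.

Lemma gfrac_scale d a m : (d%:R : Z) \is a GRing.unit ->
  (m%:R : Z) \is a GRing.unit -> gfrac (m * a) (m * d) = gfrac a d.
Proof.
move=> du mu; rewrite /gfrac; congr pgamma.
have mdu : ((m * d)%:R : Z) \is a GRing.unit by rewrite natrM unitrM mu.
by apply: (mulIr mdu); rewrite divrK // !natrM [RHS]mulrCA divrK.
Qed.

Lemma gratE b : grat b = gfrac b q.
Proof. by []. Qed.

Lemma grat_half : pgamma (1 / 2%:R : Z) = grat h.
Proof.
have hu : (h%:R : Z) \is a GRing.unit by apply: natr_unit_small; lia.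
have u2 : (2%:R : Z) \is a GRing.unit by apply: natr_unit_small; lia.
by rewrite gratE qE -{1}[h]muln1 gfrac_scale.
Qed.

Lemma grat_duplication b : (b < p)%N ->
  gfrac b (2 * q) * gfrac (b + q) (2 * q) =
  teich 2%:R ^+ b * grat h * grat b.
Proof.
move=> bp; have u2 : (2%:R : Z) \is a GRing.unit by apply: natr_unit_small; lia.
have := @grat_multiplication p p_pr p_gt2 2 b isT _ bp.
rewrite !big_ord_recl !big_ord0 /= !mulr1 !div_div_add // mul0n addn0 mul1n.
rewrite mul0r pgamma0 // mul1r grat_half; apply.
by rewrite gtnNdvd.
Qed.

Lemma grat_triplication b : (b < p)%N ->
  gfrac b (3 * q) * (gfrac (b + q) (3 * q) * gfrac (b + 2 * q) (3 * q)) =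
  teich 3%:R ^+ b * (gfrac 1 3 * gfrac 2 3) * grat b.
Proof.
move=> bp; have u3 : (3%:R : Z) \is a GRing.unit by apply: natr_unit_small; lia.
have := @grat_multiplication p p_pr p_gt2 3 b isT _ bp.
rewrite !big_ord_recl !big_ord0 /= !mulr1 !div_div_add // mul0n addn0 mul1n.
rewrite mul0r pgamma0 // mul1r; apply.
by rewrite gtnNdvd.
Qed.

(** The values of Gamma at the fractional parts of 1/6 - m/q and 5/6 - m/q *)
Definition gsixth m : Z :=
  gfrac (h + (if (h < 3 * m)%N then (3 * q)%N else 0%N) - 3 * m) (3 * q).
Definition gfivesixth m : Z :=
  gfrac (5 * h + (if (5 * h < 3 * m)%N then (3 * q)%N else 0%N) - 3 * m) (3 * q).

(** The exponent of - p in the m-th term of the hypergeometric function *)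
Definition carry m : nat := ((h < 3 * m) + (5 * h < 3 * m))%N.

(** Representatives of h - m and h - 3 m modulo q *)
Definition res1 m := (if (m <= h)%N then h - m else h + q - m)%N.
Definition res3 m := (if (3 * m <= h)%N then h - 3 * m else
  if (m <= h)%N then h + q - 3 * m else
  if (3 * m <= 5 * h)%N then h + 2 * q - 3 * m else h + 3 * q - 3 * m)%N.

Lemma h_bounds : (0 < h)%N /\ (q < p)%N.
Proof. by move: qE; rewrite /q; lia. Qed.

Lemma grat_res1 m : (m < q)%N -> grat (res1 m) = gfrac (3 * res1 m) (3 * q).
Proof.
by move=> mq; rewrite gfrac_scale ?q_unit //; apply: natr_unit_small; lia.
Qed.

Lemma res3_lt m : (m < q)%N -> (res3 m < q)%N.
Proof. by move=> mq; move: qE; rewrite /res3; do 3?[case: ifP] => *; lia. Qed.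

(** The numbers 1/6, 1/2 and 5/6 minus m/q, taken modulo 1, are the three thirds
    of h - 3 m over q modulo 1. *)
Lemma gsixth_triplication m : (m < q)%N ->
  gsixth m * gfivesixth m * grat (res1 m) =
  teich 3%:R ^+ res3 m * (gfrac 1 3 * gfrac 2 3) * grat (res3 m).
Proof.
move=> mq; have [h0 qp] := h_bounds.
rewrite -grat_triplication ?(ltn_trans (res3_lt mq)) // grat_res1 //.
rewrite /gsixth /gfivesixth; set a5 := (5 * h + _ - _)%N.
set a1 := (h + _ - _)%N; set n := res3 m; set c := (3 * res1 m)%N.
(* The three arguments are the same up to a cyclic permutation. *)
have [[e1 [e2 e3]]|[[e1 [e2 e3]]|[e1 [e2 e3]]]] :
    (n = a1 /\ n + q = c /\ n + 2 * q = a5)%N \/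
    (n = c /\ n + q = a5 /\ n + 2 * q = a1)%N \/
    (n = a5 /\ n + q = a1 /\ n + 2 * q = c)%N.
- move: qE; rewrite {}/n {}/c {}/a5 {}/a1 /res1 /res3.
  case: (leqP (3 * m) h) => c1; case: (leqP m h) => c2;
    case: (leqP (3 * m) (5 * h)) => c3 qh;
    first [exfalso; lia | left; lia | right; left; lia | right; right; lia].
all: rewrite e2 e3 e1; ring.
Qed.

(** The factor of omega ^ (- m) in the m-th term of the hypergeometric function *)
Definition mccarthy_coef m : Z :=
  (- p%:R) ^+ carry m * (gsixth m * gfivesixth m) * grat m ^+ 2 *
  (gsixth 0 * gfivesixth 0)^-1.

Lemma gsixth0_unit : gsixth 0 * gfivesixth 0 \is a GRing.unit.
Proof. by rewrite unitrM !gfrac_unit. Qed.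

Lemma three_neq0 : (3%:R : 'F_p) != 0.
Proof. by apply: natF_neq0. Qed.

Lemma teich3_half : teich 3%:R ^+ h * teich 3%:R ^+ h = 1.
Proof. by rewrite -exprD addnn -muln2 -qE teich_exp // three_neq0. Qed.

(** The constant Gamma(1/3) Gamma(2/3) is eliminated with the case m = 0. *)
Lemma gsixth_ratio m : (m < q)%N ->
  gsixth m * gfivesixth m * grat (res1 m) =
  teich 3%:R ^+ (3 * (q - m)) * (gsixth 0 * gfivesixth 0) * grat (res3 m).
Proof.
move=> mq; have [h0 qp] := h_bounds; have q0 : (0 < q)%N by lia.
rewrite gsixth_triplication //.
have := gsixth_triplication q0; rewrite /res1 /res3 muln0 leq0n !subn0.
move/(mulIr (grat_unit p_pr p_gt2 h)) => ->.
rewrite [X in _ = X * _]mulrA -exprD -/(res3 m).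
congr (_ * _ * _); apply: teich_expM; first exact: three_neq0.
rewrite -/q /res3; case: (leqP (3 * m) h) => c1.
  have -> : (3 * (q - m) + h = h - 3 * m + 3 * q)%N by lia.
  by rewrite [in RHS]addnC modnMDl.
case: (leqP m h) => c2.
  have -> : (3 * (q - m) + h = h + q - 3 * m + 2 * q)%N by lia.
  by rewrite [in RHS]addnC modnMDl.
case: (leqP (3 * m) (5 * h)) => c3.
  have -> : (3 * (q - m) + h = h + 2 * q - 3 * m + 1 * q)%N by lia.
  by rewrite [in RHS]addnC modnMDl.
by congr (_ %% _)%N; lia.
Qed.

Lemma jac1E m : (m < q)%N ->
  grat h * jac1 p_pr m =
  - ((if (h < m)%N then - p%:R else 1) * grat m * grat (res1 m)).
Proof.
move=> mq; have [h0 qp] := h_bounds.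
rewrite jacobi_pgamma //; last by rewrite h0; move: qE; rewrite -/q; lia.
by rewrite /res1 [(m <= h)%N]leqNgt; case: ltnP.
Qed.

(** Representative of 2 m modulo q *)
Definition res2 m := (if (m < h)%N then 2 * m else 2 * m - q)%N.

Lemma jac2E m : (m < q)%N -> m != h ->
  grat (res1 m) * jac2 p_pr m =
  - ((if (res1 m < res2 m)%N then - p%:R else 1) * grat (res2 m) * grat (res3 m)).
Proof.
move=> mq mh; have [h0 qp] := h_bounds.
have b2 : (res2 m < q)%N by move: qE; rewrite /res2; case: (ltnP m h) => *; lia.
have c2 : (0 < res1 m < q)%N by move: qE; rewrite /res1; case: (leqP m h) => *; lia.
have -> : jac2 p_pr m =
    \sum_y chi (q - res2 m) y * chi (res1 m) (1 + y).
  apply: eq_bigr => y _; congr (_ * _); apply: eq_chi; rewrite -/q.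
    rewrite /res2; case: (ltnP m h) => hm.
      have -> : ((q - m) * 2 = q - 2 * m + q)%N by move: qE; lia.
      by rewrite modnDr.
    by congr (_ %% _)%N; move: qE; lia.
  rewrite -/h /res1; case: (leqP m h) => hm.
    have -> : (h + (q - m) = h - m + q)%N by lia.
    by rewrite modnDr.
  by congr (_ %% _)%N; lia.
rewrite jacobi_pgamma //; congr (- (_ * grat _)).
move: qE; rewrite /res1 /res2 /res3 -/q; case: (leqP (3 * m) h) => c1;
  case: (leqP m h) => c3; case: (leqP (3 * m) (5 * h)) => c4 qh;
  case: (ltnP m h) => c5; case: ltnP => c6; lia.
Qed.

Lemma carryE m : (m < q)%N -> m != h ->
  (if (h < m)%N then - p%:R else 1) *
  (if (res1 m < res2 m)%N then - p%:R else 1) = (- p%:R) ^+ carry m :> Z.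
Proof.
move=> mq mh.
have -> : carry m = ((h < m)%N + (res1 m < res2 m)%N)%N.
  move: qE; rewrite /carry /res1 /res2; case: (leqP (3 * m) h) => c1;
  case: (leqP m h) => c3; case: (leqP (3 * m) (5 * h)) => c4 qh;
  case: (ltnP m h) => c5; case: ltnP => c6; lia.
by rewrite exprD; case: (h < m)%N; case: (res1 m < res2 m)%N.
Qed.

Lemma grat_duplication_res m : (m < q)%N -> m != h ->
  exists k, [/\ (k < p)%N, res1 m = (q - k)%N, odd k = odd (m + h) &
    grat m * grat k = teich 2%:R ^+ (m * 2) * grat h * grat (res2 m)].
Proof.
move=> mq mh; have [h0 qp] := h_bounds.
have u2 : (2%:R : Z) \is a GRing.unit by apply: natr_unit_small; lia.
have two0 : (2%:R : 'F_p) != 0 by rewrite natF_neq0.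
have b2 : (res2 m < p)%N by move: qE; rewrite /res2; case: (ltnP m h) => *; lia.
have e2 : teich 2%:R ^+ (m * 2) = teich 2%:R ^+ res2 m.
  apply: teich_expM => //; rewrite -/q /res2; case: (ltnP m h) => hm.
    by rewrite mulnC.
  have -> : (m * 2 = 2 * m - q + q)%N by move: qE; lia.
  by rewrite modnDr.
rewrite e2 -grat_duplication // /res2 /res1.
case: (ltnP m h) => hm.
  exists (m + h)%N; split; [by lia|by rewrite ltnW //; move: qE; lia|by []|].
  rewrite !gratE -(gfrac_scale m q_unit u2) -(gfrac_scale (m + h) q_unit u2).
  by congr (_ * gfrac _ _); move: qE; lia.
exists (m - h)%N; split; [by lia| |by rewrite oddB ?oddD|].
  by rewrite ifN; move: qE; lia.
rewrite mulrC !gratE -(gfrac_scale m q_unit u2) -(gfrac_scale (m - h) q_unit u2).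
by congr (gfrac _ _ * gfrac _ _); move: qE; lia.
Qed.

Lemma grat_half_sqr : grat h * grat h = - (-1) ^+ h.
Proof.
have [h0 qp] := h_bounds; rewrite -grat_reflection //; last by move: qE; lia.
by congr (_ * grat _); rewrite -/q; move: qE; lia.
Qed.

(** For m != h, multiply the two Jacobi sums: the values at h - m cancel, the
    triplication formula absorbs the value at h - 3 m, the duplication formula
    the value at 2 m, and the reflection formula removes what is left. The powers
    of omega(2) and omega(3) cancel against the constants 4 and 27. For m = h the
    second Jacobi sum is the degenerate [jac2_half]. *)
Lemma cubic_coef_mccarthy m : (m < q)%N ->
  mccarthy_coef m = chi h 3%:R * cubic_coef p_pr m.
Proof.
move=> mq; have [h0 qp] := h_bounds; have t30 := three_neq0.
have uH := grat_unit p_pr p_gt2 h; have uX := gsixth0_unit.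
have E := gsixth_ratio mq.
rewrite cubic_coefE // -/q -/h.
have chi27 k : chi k 27%:R = teich 3%:R ^+ (3 * k).
  rewrite (_ : 27%:R = 3%:R ^+ 3 :> 'F_p); last by ring.
  rewrite teich_charE ?expf_neq0 // exprM; congr (_ ^+ _).
  by rewrite !exprS !expr0 !mulr1 !teichM ?mulf_neq0.
have chi4 : chi m 4%:R = teich 2%:R ^+ (m * 2).
  have two0 : (2%:R : 'F_p) != 0 by rewrite natF_neq0.
  by rewrite (natrM _ 2 2) -expr2 chi_sqr teich_charE.
rewrite chi27 (teich_charE _ _ t30); set t3 := teich 3%:R.
have t3h := teich3_half; rewrite -/t3 in t3h E.
apply: (mulIr uX); rewrite /mccarthy_coef divrK //.
set X := gsixth 0 * gfivesixth 0 in uX E *.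
have [mh|mh] := eqVneq m h.
  subst m; rewrite jac2_half // chi_h4 //.
  have r1 : res1 h = 0%N by rewrite /res1 leqnn subnn.
  have J1 := jac1E mq; rewrite ltnn r1 grat0 // mul1r mulr1 in J1.
  have {}J1 : jac1 p_pr h = -1.
    by apply: (mulrI uH); rewrite J1 mulrN1.
  have r3 : res3 h = 0%N.
    by rewrite /res3 leqnn ifN; [move: qE; lia|lia].
  rewrite r1 r3 grat0 // !mulr1 in E; rewrite E J1.
  have -> : carry h = 1%N by rewrite /carry; do 2?[case: ltnP => ?]; lia.
  have -> : (3 * (q - h) = h + h + h)%N by move: qE; lia.
  have -> : (3 * (h + (q - h)) = h + h + (h + h) + (h + h))%N by move: qE; lia.
  rewrite !exprD t3h !mulr1 !mul1r expr2 grat_half_sqr.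
  have -> : q%:R = p%:R - 1 :> Z by rewrite -(@natrB _ p 1) ?prime_gt0 // subn1.
  by rewrite expr1; ring.
rewrite addr0.
have J1 := jac1E mq; have J2 := jac2E mq mh; have C := carryE mq mh.
have [k [kp r1k kodd D]] := grat_duplication_res mq mh.
have uD := grat_unit p_pr p_gt2 (res1 m).
have R : grat k * grat (res1 m) = (-1) ^+ m * (grat h * grat h).
  rewrite r1k grat_reflection // grat_half_sqr mulrN -exprD; congr (- _).
  by rewrite -signr_odd kodd signr_odd.
have t3x : t3 ^+ (3 * (h + (q - m))) = t3 ^+ h * t3 ^+ (3 * (q - m)).
  have -> : (3 * (h + (q - m)) = h + h + h + 3 * (q - m))%N by lia.
  by rewrite !exprD t3h mul1r.
have mm : (-1) ^+ m * (-1) ^+ m = 1 :> Z.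
  by rewrite -exprD addnn -muln2 mulnC exprM sqrrN !expr1n.
rewrite chi4 t3x -C.
move: J1 J2 R E D.
set G := grat m; set H := grat h in uH *; set Dd := grat (res1 m) in uD *.
set e1 := (if (h < m)%N then _ else _); set e2 := (if (_ < res2 m)%N then _ else _).
set B := grat (res2 m); set N3 := grat (res3 m); set M := grat k.
set s := (-1) ^+ m in mm *; set t2 := teich 2%:R ^+ (m * 2).
set T := t3 ^+ (3 * (q - m)); set th := t3 ^+ h in t3h *.
set X15 := gsixth m * gfivesixth m; move=> J1 J2 R E D.
apply: (mulIr uH); apply: (mulIr uD).
have K : s * t2 * B * Dd = G * H.
  apply: (mulrI uH).
  transitivity (s * (t2 * H * B) * Dd); first by ring.
  rewrite -D; transitivity (s * G * (M * Dd)); first by ring.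
  by rewrite R; transitivity (s * s * G * H * H); [ring | rewrite mm; ring].
transitivity (e1 * e2 * G * (G * H) * (X15 * Dd)); first by ring.
rewrite E -K.
transitivity (th * th * s * t2 * T * X * (- (e1 * G * Dd)) * (- (e2 * B * N3))).
  by rewrite t3h; ring.
by rewrite -J1 -J2; ring.
Qed.

End Coefficients.

(** * Evaluation of the hypergeometric function *)

Lemma floor_fracpartE (x : rat) a d (z : int) : (a < d)%N ->
  x = a%:R / d%:R + z%:~R -> Num.floor x = z /\ fracpart x = a%:R / d%:R.
Proof.
move=> ad xE; suff fz : Num.floor x = z by rewrite /fracpart fz xE addrK.
have d0 : (0 : rat) < d%:R by rewrite ltr0n (leq_trans _ ad).
apply/eqP; rewrite floor_eq xE intrD lerDr [_ + 1%:~R]addrC ltrD2r.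
rewrite ltr_pdivrMr // mul1r.
by rewrite divr_ge0 ?ler0n // ltr_nat.
Qed.

Section Assembly.
Variables (p : nat) (p_pr : prime p).
Hypothesis p_gt3 : (3 < p)%N.
Local Notation Z := (zpadic p_pr).
Local Notation chi := (teich_char p_pr).
Local Notation grat := (@grat p p_pr).

Let q := p.-1.
Let h := q./2.
Let qE : q = (h * 2)%N. Proof. exact: q_double. Qed.
Let h0 : (0 < h)%N. Proof. by move: qE; rewrite /q; lia. Qed.

Lemma ratr_frac a d : (d%:R : Z) \is a GRing.unit ->
  ratr (a%:R / d%:R) = a%:R / d%:R :> Z.
Proof.
rewrite /ratr !pmulrn; case: divqP => [|k x k0]; first by rewrite unitr0.
rewrite !intrM unitrM => /andP[ku du].
apply: (mulIr (_ : k%:~R * (denq x)%:~R \is a GRing.unit)).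
  by rewrite unitrM ku.
by rewrite [RHS]divrK ?unitrM ?ku // mulrCA divrK.
Qed.

Lemma six_unit : (6%:R : Z) \is a GRing.unit.
Proof.
by rewrite (natrM _ 2 3) unitrM !natr_unit_small //; lia.
Qed.

Lemma threeq_unit : ((3 * q)%:R : Z) \is a GRing.unit.
Proof. by rewrite natrM unitrM q_unit // natr_unit_small //; lia. Qed.

Lemma gsixth0 : gsixth p_pr 0 = gfrac p_pr 1 6.
Proof.
rewrite /gsixth ltn0 -/q -/h addn0 muln0 subn0.
have -> : (3 * q = h * 6)%N by move: qE; lia.
rewrite -{1}[h]muln1 gfrac_scale ?six_unit // natr_unit_small //.
by move: qE; rewrite /q; lia.
Qed.

Lemma gfivesixth0 : gfivesixth p_pr 0 = gfrac p_pr 5 6.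
Proof.
rewrite /gfivesixth ltn0 -/q -/h addn0 muln0 subn0.
have -> : (3 * q = h * 6)%N by move: qE; lia.
rewrite mulnC gfrac_scale ?six_unit // natr_unit_small //.
by move: qE; rewrite /q; lia.
Qed.

Lemma sixth_sub j m : (m < q)%N -> (j * h < 3 * q)%N ->
  j%:R / 6%:R - m%:R / q%:R =
  (j * h + (if (j * h < 3 * m)%N then (3 * q)%N else 0%N) - 3 * m)%N%:R / (3 * q)%N%:R
  + (- Posz (j * h < 3 * m)%N)%:~R :> rat.
Proof.
move=> mq jq; have hR : (h%:R : rat) != 0 by rewrite pnatr_eq0; lia.
rewrite natrB; last by case: (ltnP (j * h) (3 * m)) => ?; lia.
rewrite mulrNz -pmulrn natrD !natrM.
have -> : q%:R = h%:R * 2%:R :> rat by rewrite -natrM; congr (_%:R); exact: qE.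
by case: (ltnP (j * h) (3 * m)) => _ /=; rewrite ?qE ?natrM; field.
Qed.

Lemma sixth_sub_lt j m : (m < q)%N -> (j * h < 3 * q)%N ->
  (j * h + (if (j * h < 3 * m)%N then (3 * q)%N else 0%N) - 3 * m < 3 * q)%N.
Proof. by move=> mq jq; case: (ltnP (j * h) (3 * m)) => ?; lia. Qed.

(** Stated over an arbitrary field receiving Z_p and for unspecified rational
    parameters, to keep the constructions of Q_p and of the rationals out of
    the computation. *)
Lemma mccarthy_term_generic (F : fieldType) (io : {rmorphism Z -> F})
    (A1 A5 B r : rat) (X1 X5 Y1 Y5 W T : Z) (w1 w5 m : nat)
    (G := fun x : rat => io (pgamma (ratr x : Z)))
    (a := [tuple A1; A5]) (b := [tuple B; B]) :
  Num.floor (fracpart A1 - r) = - Posz w1 ->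
  Num.floor (fracpart A5 - r) = - Posz w5 ->
  Num.floor (fracpart (- B) + r) = 0 ->
  pgamma (ratr (fracpart (A1 - r)) : Z) = X1 ->
  pgamma (ratr (fracpart (A5 - r)) : Z) = X5 ->
  pgamma (ratr (fracpart A1) : Z) = Y1 -> pgamma (ratr (fracpart A5) : Z) = Y5 ->
  pgamma (ratr (fracpart (- B + r)) : Z) = W ->
  pgamma (ratr (fracpart (- B)) : Z) = 1 ->
  Y1 * Y5 \is a GRing.unit ->
  (-1) ^+ (m * 2) * io T *
  \prod_(k < 2)
    ((- (p%:R : F)) ^ (- Num.floor (fracpart (tnth a k) - r)
                       - Num.floor (fracpart (- tnth b k) + r)) *
     (G (fracpart (tnth a k - r)) / G (fracpart (tnth a k))) *
     (G (fracpart (- tnth b k + r)) / G (fracpart (- tnth b k)))) =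
  io (T * ((- p%:R) ^+ (w1 + w5) * (X1 * X5) * W ^+ 2 * (Y1 * Y5)^-1)).
Proof.
move=> f1 f5 fB g1 g5 h1 h5 gB hB uY.
rewrite !big_ord_recl big_ord0 mulr1 !(tnth_nth 0) /= /G.
rewrite f1 f5 fB g1 g5 h1 h5 gB hB !subr0 !opprK rmorph1 divr1.
rewrite mulnC exprM sqrrN !expr1n mul1r.
have [y1 y5] : io Y1 != 0 /\ io Y5 != 0.
  move: uY; rewrite unitrM => /andP[u1 u5].
  by rewrite -!unitfE !rmorph_unit.
rewrite !rmorphM /= rmorphV // rmorphM !rmorphXn rmorphN rmorph_nat /=.
rewrite -!exprnP exprD; move: (_ ^+ w1) (_ ^+ w5) => z1 z5.
move: y1 y5; move: (io X1) (io X5) (io Y1) (io Y5) (io W) (io T).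
by move=> x1 x5 y1 y5 w u y10 y50; field; rewrite y10 y50.
Qed.

Lemma mccarthy_term (F : fieldType) (io : {rmorphism Z -> F}) m t
    (r := m%:R / (p.-1)%:R : rat)
    (G := fun x : rat => io (pgamma (ratr x : Z)))
    (a := [tuple (1 / 6%:R : rat); 5%:R / 6%:R]) (b := [tuple (0 : rat); 0]) :
  (m < q)%N ->
  (-1) ^+ (m * 2) * io (teichmuller_bar_exp p_pr m t) *
  \prod_(k < 2)
    ((- (p%:R : F)) ^ (- Num.floor (fracpart (tnth a k) - r)
                       - Num.floor (fracpart (- tnth b k) + r)) *
     (G (fracpart (tnth a k - r)) / G (fracpart (tnth a k))) *
     (G (fracpart (- tnth b k + r)) / G (fracpart (- tnth b k)))) =
  io (teichmuller_bar_exp p_pr m t * mccarthy_coef p_pr m).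
Proof.
move=> mq; have [j1 j5] : (1 * h < 3 * q)%N /\ (5 * h < 3 * q)%N by lia.
have [f1 g1] := floor_fracpartE (sixth_sub_lt mq j1) (sixth_sub mq j1).
have [f5 g5] := floor_fracpartE (sixth_sub_lt mq j5) (sixth_sub mq j5).
have [_ e1] := @floor_fracpartE (1%:R / 6%:R) 1 6 0 isT (esym (addr0 _)).
have [_ e5] := @floor_fracpartE (5%:R / 6%:R) 5 6 0 isT (esym (addr0 _)).
have [fr gr] := @floor_fracpartE r m q 0 mq (esym (addr0 _)).
have e0 : fracpart (- 0) = 0.
  have z : - 0 = 0%:R / 1%:R + 0%:~R :> rat by rewrite oppr0 mul0r addr0.
  by have [_ ->] := floor_fracpartE (ltn0Sn 0) z; rewrite mul0r.
apply: mccarthy_term_generic (gsixth0_unit p_pr p_gt3).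
- by rewrite e1 f1 mul1n.
- by rewrite e5 f5.
- by rewrite e0 add0r fr.
- by rewrite g1 (ratr_frac _ threeq_unit) mul1n.
- by rewrite g5 (ratr_frac _ threeq_unit).
- by rewrite e1 (ratr_frac _ six_unit) gsixth0.
- by rewrite e5 (ratr_frac _ six_unit) gfivesixth0.
- by rewrite oppr0 add0r gr (ratr_frac _ (q_unit p_pr p_gt3)).
- by rewrite e0 /ratr mul0r; exact: (pgamma0 p_pr (ltnW p_gt3)).
Qed.

Lemma bar_expE m t : t != 0 -> teichmuller_bar_exp p_pr m (1 / t) = chi m t.
Proof.
move=> t0; rewrite /teichmuller_bar_exp mul1r invr_eq0 (negPf t0) teichV //.
by rewrite invrK teich_charE.
Qed.

Lemma mccarthy_cubic_sum t : t != 0 ->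
  mccarthy_G p_pr [tuple (1 / 6%:R : rat); 5%:R / 6%:R] [tuple (0 : rat); 0]
    (1 / t) =
  zpadic_to_qpadic (- (chi h 3%:R * cubic_sum p_pr t)).
Proof.
move=> t0; rewrite /mccarthy_G big_mkord.
transitivity (- 1 / (p.-1)%:R * \sum_(m < q)
   zpadic_to_qpadic (chi h 3%:R * (chi m t * cubic_coef p_pr m))).
  congr (_ * _); apply: eq_bigr => m _.
  rewrite [RHS](_ : _ = zpadic_to_qpadic (teichmuller_bar_exp p_pr m (1 / t)
     * mccarthy_coef p_pr m)); last first.
    by rewrite bar_expE // cubic_coef_mccarthy // mulrCA.
  exact: (mccarthy_term (@zpadic_to_qpadic p p_pr) (1 / t) (ltn_ord m)).
rewrite -rmorph_sum -mulr_sumr cubic_inversion // -/q mulrCA.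
rewrite rmorphM rmorph_nat rmorphN mulrA divfK ?mulN1r //.
have -> : q = p.-2.+1 by rewrite /q; lia.
exact: qpadic_char0.
Qed.

(** Euler's criterion at -1: for even h, a y with y ^ h != 1 has y ^ h = -1, which
    is the square of y ^ (h / 2). *)
Lemma quad_charN1 : quad_char (-1 : 'F_p) = (-1) ^+ h.
Proof.
have p_gt2 : (2 < p)%N by exact: ltnW.
have N1 : (1 : Z) != -1.
  rewrite eq_sym -subr_eq0 -opprD oppr_eq0 (zpadic_natr_eq0 p_pr 2).
  by [].
rewrite /quad_char oppr_eq0 oner_eq0 /= -signr_odd; case: ifP => [/existsP[y]|].
  move=> /eqP yE; have y0 : y != 0.
    by apply: contra_eq_neq yE => ->; rewrite expr0n eq_sym oppr_eq0 oner_eq0.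
  have : (-1) ^+ h = 1 :> Z.
    by rewrite -chiN1 // -yE chi_sqr -qE teich_charE // teich_exp.
  by rewrite -signr_odd; case: (odd h) => // /eqP; rewrite eq_sym (negPf N1).
move/negbT; rewrite negb_exists => /forallP nsq; case: (boolP (odd h)) => // hev.
have [y y0 yh] : exists2 y : 'F_p, y != 0 & teichmuller p_pr y ^+ h != 1.
  apply: contrapT => no; have := sum_teich p_pr h.
  rewrite gtnNdvd // -/q; last by move: qE; lia.
  rewrite (eq_bigr (fun=> 1)) => [|y y0]; last first.
    by apply/eqP/negPn/negP => yh; apply: no; exists y.
  rewrite sumr_const cardC1 card_Fp // => /eqP.
  by rewrite zpadic_natr_eq0 => /eqP; move: qE; rewrite /q; lia.
case/negP: (nsq (y ^+ h./2)); rewrite -exprM muln2 even_halfK //.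
have : (y ^+ h) ^+ 2 == 1 ^+ 2.
  rewrite -exprM -qE expr1n -{1}(residue_teich p_pr y0) -residueX.
  by rewrite teich_exp // residue1.
rewrite eqf_sqr => /orP[/eqP y1|//]; case/negP: yh; apply/eqP.
apply: rootunity_inj; rewrite ?expr1n // -?exprM.
  by rewrite mulnC exprM teich_exp // expr1n.
by rewrite -residue_eq residueX residue_teich // y1 residue1.
Qed.

End Assembly.

Theorem theorem1p2 (p : nat) (p_pr : prime p) (p_gt3 : (3 < p)%N)
    (t : 'F_p) (t_neq0 : t <> 0) (t_neq1 : t <> 1) :
  mccarthy_G p_pr [tuple (1 / 6%:R : rat); 5%:R / 6%:R] [tuple (0 : rat); 0]
    (1 / t) =
  (quad_char (-1 : 'F_p))%:~R *
  mccarthy_G p_pr [tuple (1 / 6%:R : rat); 5%:R / 6%:R] [tuple (0 : rat); 0]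
    (1 / (1 - t)).
Proof.
have t0 : t != 0 by apply/eqP.
have t1 : 1 - t != 0 by rewrite subr_eq0 eq_sym; apply/eqP.
rewrite !mccarthy_cubic_sum // quad_charN1 // cubic_sum_refl //.
rewrite -(rmorph_int (@zpadic_to_qpadic p p_pr)) rmorphXn /= mulrN1z -rmorphM.
congr zpadic_to_qpadic; set s := (-1) ^+ _.
have ss : s * s = 1 :> zpadic p_pr.
  by rewrite /s -exprD addnn -muln2 mulnC exprM sqrrN !expr1n.
by rewrite -[LHS]mul1r -[X in X * _ = _]ss; ring.
Qed.
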